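(* Let $k$ be an algebraically closed field of characteristic $p>0$, let $\mathcal{E}$ be an elementary abelian group scheme over $k$, let $j\in\{1,\ldots,p-1\}$, and let $M$ be a finite-dimensional $k\mathcal{E}$-module of constant $j$-rank. Let $U_{\mathcal{E}}=\{[u]\in\mathbb{P}(\mathrm{Rad}(k\mathcal{E})) : u\notin\mathrm{Rad}^2(k\mathcal{E})\}$. Then: (1) The map $\mathrm{Im}^j_M:U_{\mathcal{E}}\to\mathrm{Gr}_{\mathrm{rk}^j(M)}(M)$, $[u]\mapsto\mathrm{im}(u_M^j)$, is a homogeneous morphism. (2) If $\mathcal{E}$ has abelian unipotent rank $\ge 2$ and $V\subseteq\mathrm{Rad}(k\mathcal{E})$ is a subspace such that $\mathrm{Rad}(k\mathcal{E})=V\oplus\mathrm{Rad}^2(k\mathcal{E})$, then $\mathbb{P}(V)\subseteq U_{\mathcal{E}}$, and \[ \deg(\mathrm{pl}_M\circ\mathrm{Im}^j_M)=\deg(\mathrm{pl}_M\circ\mathrm{Im}^j_M|_{\mathbb{P}(V)}).\]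
   Context: $k\mathcal{E}=k[\mathcal{E}]^\ast$ is the algebra of measures of $\mathcal{E}$; for $u\in k\mathcal{E}$, $u_M$ is the operator $m\mapsto um$ on $M$. An abelian finite group scheme $\mathcal{E}$ is elementary abelian if it is a product $\mathcal{E}=\mathcal{E}_1\cdots\mathcal{E}_n$ of subgroups, each isomorphic to a Frobenius kernel $\mathbb{G}_{a(r_i)}$ of the additive group or to the constant group $\mathbb{Z}/(p)$. Then $k\mathcal{E}\cong k[X_1,\ldots,X_n]/(X_1^p,\ldots,X_n^p)$ as an algebra for a unique $n$, which is the abelian unipotent rank of $\mathcal{E}$. Let $\mathfrak{A}_p=k[T]/(T^p)$, $t=T+(T^p)$. A $p$-point of $\mathcal{E}$ is an algebra homomorphism $\alpha:\mathfrak{A}_p\to k\mathcal{E}$ making $k\mathcal{E}$ a projective $\mathfrak{A}_p$-module; via $\alpha\mapsto\alpha(t)$, the $p$-points correspond to the elements of $\mathrm{Rad}(k\mathcal{E})\setminus\mathrm{Rad}^2(k\mathcal{E})$. $\mathrm{rk}^j(M)$ is the maximum of $\mathrm{rk}(\alpha(t)_M^j)$ over all $p$-points, and $M$ has constant $j$-rank if $\mathrm{rk}(\alpha(t)_M^j)=\mathrm{rk}^j(M)$ for all $p$-points $\alpha$. $U_{\mathcal{E}}$ is open in the projective space $\mathbb{P}(\mathrm{Rad}(k\mathcal{E}))$. $\mathrm{Gr}_d(M)$ is the Grassmannian of $d$-dimensional subspaces ($\mathrm{Gr}_0(M)$ is a point), regarded as a closed subvariety of $\mathbb{P}(\bigwedge^d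 M)$ via the Plücker embedding $\mathrm{pl}_M$. A morphism $\varphi:X\to Y$ of quasi-projective varieties $X\subseteq\mathbb{P}^n$, $Y\subseteq\mathbb{P}^m$ is homogeneous if there are homogeneous polynomials $f_0,\ldots,f_m\in k[X_0,\ldots,X_n]$ of the same degree, without common zero on $X$, with $\varphi(x)=(f_0(x):\cdots:f_m(x))$ for all $x\in X$. If $X$ is a non-empty open subset of $\mathbb{P}^n$, every morphism $X\to\mathbb{P}^m$ is homogeneous and the $f_i$ may be chosen with $\gcd(f_0,\ldots,f_m)=1$; they are then unique up to a common non-zero scalar and $\deg(\varphi)$ is their common degree (applied here to $U_{\mathcal{E}}\subseteq\mathbb{P}(\mathrm{Rad}(k\mathcal{E}))$ and to $\mathbb{P}(V)$). *)

(* Defs.v *)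
From HB Require Import structures.
From mathcomp Require Import all_boot all_order all_algebra all_field.
From mathcomp.multinomials Require Import mpoly.
From Stdlib Require Import ClassicalEpsilon.

Set Implicit Arguments.
Unset Strict Implicit.
Unset Printing Implicit Defensive.

Import GRing.Theory.
Local Open Scope ring_scope.

(** * Tensor products of finite-dimensional vector spaces *)

(* An element of A (x) B is its coefficient matrix in the basis
   e_i (x) e_j, where e_i is the i-th vector of vbasis fullv. *)
Definition tens (k : fieldType) (A B : vectType k) :=
  'M[k]_(\dim {:A}, \dim {:B}).

HB.instance Definition _ (k : fieldType) (A B : vectType k) :=
  Vector.copy (tens A B) 'M[k]_(\dim {:A}, \dim {:B}).

Section Tensor.
Variable k : fieldType.

Definition ebasis (A : vectType k) (i : 'I_(\dim {:A})) : A :=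
  (vbasis {:A})`_i.
Definition ecoord (A : vectType k) (i : 'I_(\dim {:A})) (x : A) : k :=
  coord (vbasis {:A}) i x.

Lemma ecoordK (A : vectType k) (x : A) :
  x = \sum_i ecoord i x *: ebasis i.
Proof. exact: coord_vbasis (memvf x). Qed.

Definition pure (A B : vectType k) (a : A) (b : B) : tens A B :=
  \matrix_(i, j) (ecoord i a * ecoord j b).

(* For a bilinear b, the linear map x (x) y |-> b x y. *)
Definition tlift (A B Z : vectType k) (b : A -> B -> Z) (t : tens A B) : Z :=
  \sum_i \sum_j (t : 'M__) i j *: b (ebasis i) (ebasis j).

Definition bilin (A B Z : vectType k) (b : A -> B -> Z) :=
  (forall y, linear (b^~ y)) /\ (forall x, linear (b x)).

Section Tlift.
Variables A B Z : vectType k.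
Implicit Types (x y : A) (a b : B) (s t : tens A B).

Fact tlift_is_linear (f : A -> B -> Z) : linear (tlift f).
Proof.
move=> c s t; rewrite /tlift scaler_sumr -big_split; apply: eq_bigr => i _ /=.
rewrite scaler_sumr -big_split; apply: eq_bigr => j _ /=.
by rewrite !mxE scalerDl scalerA.
Qed.
HB.instance Definition _ f :=
  GRing.isLinear.Build k (tens A B) Z _ (tlift f) (tlift_is_linear f).

Lemma pureDl x y a : pure (x + y) a = pure x a + pure y a.
Proof. by apply/matrixP=> i j; rewrite !mxE /ecoord linearD mulrDl. Qed.
Lemma pureDr x a b : pure x (a + b) = pure x a + pure x b.
Proof. by apply/matrixP=> i j; rewrite !mxE /ecoord linearD mulrDr. Qed.
Lemma pureZl c x a : pure (c *: x) a = c *: pure x a.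
Proof. by apply/matrixP=> i j; rewrite !mxE /ecoord linearZ /= mulrA. Qed.
Lemma pureZr c x a : pure x (c *: a) = c *: pure x a.
Proof. by apply/matrixP=> i j; rewrite !mxE /ecoord linearZ /= mulrCA. Qed.

Lemma pure_bilin : bilin (@pure A B).
Proof.
by split=> z c x y; rewrite ?pureDl ?pureZl ?pureDr ?pureZr.
Qed.

Lemma pure0l a : pure (0 : A) a = 0.
Proof. by rewrite -(scale0r (0 : A)) pureZl scale0r. Qed.

Lemma pure0r x : pure x (0 : B) = 0.
Proof. by rewrite -(scale0r (0 : B)) pureZr scale0r. Qed.

Lemma pure_suml (I : finType) (F : I -> A) a :
  pure (\sum_i F i) a = \sum_i pure (F i) a.
Proof. by apply: (big_morph (fun x => pure x a)) => [x y|]; rewrite ?pureDl ?pure0l. Qed.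
Lemma pure_sumr (I : finType) x (F : I -> B) :
  pure x (\sum_i F i) = \sum_i pure x (F i).
Proof. by apply: (big_morph (pure x)) => [a b|]; rewrite ?pureDr ?pure0r. Qed.

Lemma bilinE (f : A -> B -> Z) x a : bilin f ->
  f x a = \sum_i \sum_j (ecoord i x * ecoord j a) *: f (ebasis i) (ebasis j).
Proof.
case=> fl fr.
have flE y : f y a = \sum_j ecoord j a *: f y (ebasis j).
  pose g := GRing.isLinear.Build k B Z _ (f y) (fr y).
  pose G : {linear B -> Z} := HB.pack (f y) g.
  rewrite -[f y a]/(G a) {1}(ecoordK a) linear_sum.
  by apply: eq_bigr => j _; rewrite linearZ.
have frE b : f x b = \sum_i ecoord i x *: f (ebasis i) b.
  pose g := GRing.isLinear.Build k A Z _ (f^~ b) (fl b).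
  pose G : {linear A -> Z} := HB.pack (f^~ b) g.
  rewrite -[f x b]/(G x) {1}(ecoordK x) linear_sum.
  by apply: eq_bigr => j _; rewrite linearZ.
rewrite frE; apply: eq_bigr => i _; rewrite flE scaler_sumr.
by apply: eq_bigr => j _; rewrite scalerA.
Qed.

Lemma tliftE (f : A -> B -> Z) x a : bilin f -> tlift f (pure x a) = f x a.
Proof.
move=> /bilinE ->; apply: eq_bigr => i _; apply: eq_bigr => j _.
by rewrite !mxE.
Qed.

End Tlift.

Lemma ecoord_ebasis (A : vectType k) (i j : 'I_(\dim {:A})) :
  ecoord i (ebasis j) = (i == j)%:R.
Proof.
by rewrite /ecoord /ebasis coord_free 1?eq_sym //; apply/basis_free/vbasisP.
Qed.

Lemma tensE (A B : vectType k) (t : tens A B) :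
  t = \sum_i \sum_j pure ((t : 'M__) i j *: ebasis i) (ebasis j).
Proof.
apply/matrixP=> i j; rewrite summxE (bigD1 i) //= summxE (bigD1 j) //=.
rewrite mxE {1}/ecoord linearZ /= -!/(ecoord _ _) !ecoord_ebasis !eqxx !mulr1.
rewrite !big1 ?addr0 // => [i' ne|j' ne].
  rewrite summxE big1 // => j' _; rewrite mxE {1}/ecoord linearZ /=.
  by rewrite -!/(ecoord _ _) !ecoord_ebasis eq_sym (negPf ne) mulr0 mul0r.
by rewrite mxE !ecoord_ebasis (eq_sym j) (negPf ne) mulr0.
Qed.

Lemma tens_ind (A B : vectType k) (P : tens A B -> Prop) :
  (forall s t, P s -> P t -> P (s + t)) -> (forall a b, P (pure a b)) ->
  forall t, P t.
Proof.
move=> PD Pp t; have P0 : P 0 by rewrite -(pure0l A (0 : B)).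
rewrite [t]tensE; apply: (big_ind P) => // i _; exact: (big_ind P).
Qed.

Lemma bilin_tlift (A B C Z : vectType k) (f : C -> A -> B -> Z) :
  (forall x y, linear (fun c => f c x y)) ->
  forall t, linear (fun c => tlift (f c) t).
Proof.
move=> fl t c x y; rewrite /tlift scaler_sumr -big_split.
apply: eq_bigr => i _ /=; rewrite scaler_sumr -big_split.
by apply: eq_bigr => j _ /=; rewrite fl scalerDr !scalerA mulrC.
Qed.

End Tensor.

Arguments pure {k A B} a b.
Arguments tlift {k A B Z} b t.

(** * The algebra structure (a (x) b) (c (x) d) = ac (x) bd *)

Section TensorAlgebra.
Variables (k : fieldType) (A B : falgType k).
Implicit Types s t u : tens A B.

Definition tmul s t : tens A B :=
  tlift (fun a b => tlift (fun c d => pure (a * c) (b * d)) t) s.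

Let mul_bilin (a : A) (b : B) :
  bilin (fun c d => pure (a * c) (b * d) : tens A B).
Proof.
split=> z c x y /=.
  by rewrite mulrDr -scalerAr pureDl pureZl.
by rewrite mulrDr -scalerAr pureDr pureZr.
Qed.

Let mul_bilin2 t :
  bilin (fun (a : A) (b : B) =>
    tlift (fun c d => pure (a * c) (b * d)) t : tens A B).
Proof.
split=> z; [apply: (@bilin_tlift _ A B A) | apply: (@bilin_tlift _ A B B)];
  move=> a b c x y /=.
  by rewrite mulrDl -scalerAl pureDl pureZl.
by rewrite mulrDl -scalerAl pureDr pureZr.
Qed.

Lemma tmul_pure (a c : A) (b d : B) :
  tmul (pure a b) (pure c d) = pure (a * c) (b * d).
Proof. by rewrite /tmul tliftE // tliftE. Qed.

Lemma tmulDl : left_distributive tmul +%R.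
Proof. by move=> s t u; rewrite /tmul linearD. Qed.

Lemma tmul_linr s : linear (tmul s).
Proof. by apply: bilin_tlift => x y c t u; rewrite linearP. Qed.

Lemma tmulDr : right_distributive tmul +%R.
Proof.
by move=> s t u; have := tmul_linr s 1 t u; rewrite !scale1r.
Qed.

Lemma tmulA : associative tmul.
Proof.
move=> s t u; elim/tens_ind: s => [? ? IH1 IH2|a b].
  by rewrite !tmulDl IH1 IH2.
elim/tens_ind: t => [? ? IH1 IH2|c d]; first by rewrite !(tmulDl, tmulDr) IH1 IH2.
elim/tens_ind: u => [? ? IH1 IH2|e f]; first by rewrite !tmulDr IH1 IH2.
by rewrite !tmul_pure !mulrA.
Qed.

Lemma tmul1l : left_id (pure 1 1) tmul.
Proof.
elim/tens_ind=> [? ? IH1 IH2|a b]; first by rewrite tmulDr IH1 IH2.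
by rewrite tmul_pure !mul1r.
Qed.

Lemma tmul1r : right_id (pure 1 1) tmul.
Proof.
elim/tens_ind=> [? ? IH1 IH2|a b]; first by rewrite tmulDl IH1 IH2.
by rewrite tmul_pure !mulr1.
Qed.

Lemma tens_nontrivial : pure 1 1 != 0 :> tens A B.
Proof.
have nz (C : falgType k) : exists i, ecoord i (1 : C) != 0.
  apply/existsP; apply: contraT => /existsPn e0.
  suff /eqP : (1 : C) = 0 by rewrite oner_eq0.
  rewrite [LHS]ecoordK big1 // => i _.
  by have /negPn/eqP -> := e0 i; rewrite scale0r.
have [[i nzi] [j nzj]] := (nz A, nz B).
apply/eqP=> /matrixP/(_ i j)/eqP.
by rewrite !mxE mulf_eq0 (negPf nzi) (negPf nzj).
Qed.

HB.instance Definition _ := GRing.Zmodule_isNzRing.Build (tens A B)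
  tmulA tmul1l tmul1r tmulDl tmulDr tens_nontrivial.

Lemma tens_scaleAl (c : k) s t : c *: (s * t) = (c *: s) * t.
Proof. by rewrite -[RHS]/(tmul _ _) /tmul linearZ. Qed.
HB.instance Definition _ :=
  GRing.Lmodule_isLalgebra.Build k (tens A B) tens_scaleAl.

Lemma tens_scaleAr (c : k) s t : c *: (s * t) = s * (c *: t).
Proof.
have := tmul_linr s c t 0; rewrite !addr0 -[tmul s 0]/(s * 0) mulr0 addr0.
by move/esym.
Qed.
HB.instance Definition _ :=
  GRing.Lalgebra_isAlgebra.Build k (tens A B) tens_scaleAr.
HB.instance Definition _ := Algebra_isFalgebra.Build k (tens A B).

Lemma pureM (a c : A) (b d : B) :
  (pure a b : tens A B) * pure c d = pure (a * c) (b * d).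
Proof. exact: tmul_pure. Qed.

End TensorAlgebra.

Section TensorMaps.
Variable k : fieldType.

Lemma bilin_pure (A B C D : vectType k) (f : {linear A -> C})
    (g : {linear B -> D}) : bilin (fun a b => pure (f a) (g b)).
Proof.
by split=> z c x y; rewrite linearP ?pureDl ?pureZl ?pureDr ?pureZr.
Qed.

Lemma bilin_mul (A B : vectType k) (C : falgType k) (f : {linear A -> C})
    (g : {linear B -> C}) : bilin (fun a b => f a * g b).
Proof.
split=> z c x y; rewrite linearP ?mulrDl ?mulrDr.
  by rewrite -scalerAl.
by rewrite -scalerAr.
Qed.

Definition tmap (A B C D : vectType k) (f : 'Hom(A, C)) (g : 'Hom(B, D)) :
  'Hom(tens A B, tens C D) := linfun (tlift (fun a b => pure (f a) (g b))).

Lemma tmapE (A B C D : vectType k) (f : 'Hom(A, C)) (g : 'Hom(B, D)) a b :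
  tmap f g (pure a b) = pure (f a) (g b).
Proof. by rewrite lfunE /= tliftE //; apply: bilin_pure. Qed.

Definition tassoc (A B C : vectType k) :
    'Hom(tens (tens A B) C, tens A (tens B C)) :=
  linfun (tlift (fun s c => tlift (fun a b => pure a (pure b c)) s)).

Lemma tassocE (A B C : vectType k) (a : A) (b : B) (c : C) :
  tassoc A B C (pure (pure a b) c) = pure a (pure b c).
Proof.
have bl x : bilin (fun (a : A) (b : B) => pure a (pure b x) : tens A (tens B C)).
  by split=> z d y w; rewrite ?(pureDl, pureZl) ?(pureDr, pureZr).
rewrite lfunE /= tliftE ?tliftE //; split=> z; first exact: linearP.
by apply: (@bilin_tlift _ A B C) => x y d v w; rewrite !(pureDr, pureZr).
Qed.

Lemma tmapM (A B C D : falgType k) (f : 'AHom(A, C)) (g : 'AHom(B, D)) :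
  {morph tmap f g : s t / s * t}.
Proof.
move=> s t; elim/tens_ind: s => [? ? IH1 IH2|a b].
  by rewrite mulrDl !linearD /= IH1 IH2 mulrDl.
elim/tens_ind: t => [? ? IH1 IH2|c d].
  by rewrite mulrDr !linearD /= IH1 IH2 mulrDr.
by rewrite pureM !tmapE !rmorphM pureM.
Qed.

Lemma tassocM (A B C : falgType k) : {morph tassoc A B C : s t / s * t}.
Proof.
move=> s t; elim/tens_ind: s => [? ? IH1 IH2|u c].
  by rewrite mulrDl !linearD /= IH1 IH2 mulrDl.
elim/tens_ind: u => [? ? IH1 IH2|a b].
  by rewrite pureDl mulrDl !linearD /= IH1 IH2 mulrDl.
elim/tens_ind: t => [? ? IH1 IH2|u f].
  by rewrite mulrDr !linearD /= IH1 IH2 mulrDr.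
elim/tens_ind: u => [? ? IH1 IH2|d e].
  by rewrite pureDl mulrDr !linearD /= IH1 IH2 mulrDr.
by rewrite !pureM !tassocE !pureM.
Qed.

Lemma tpairM (A B C : falgType k) (f : {lrmorphism A -> C})
    (g : {lrmorphism B -> C}) : commutative (@GRing.mul C) ->
  {morph tlift (fun a b => f a * g b) : s t / s * t}.
Proof.
move=> mulC; have bl := bilin_mul f g.
move=> s t; elim/tens_ind: s => [? ? IH1 IH2|a b].
  by rewrite mulrDl !linearD /= IH1 IH2 mulrDl.
elim/tens_ind: t => [? ? IH1 IH2|c d].
  by rewrite mulrDr !linearD /= IH1 IH2 mulrDr.
rewrite pureM !tliftE // !rmorphM !mulrA; congr (_ * _).
by rewrite -!mulrA; congr (_ * _); apply: mulC.
Qed.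

End TensorMaps.

(** * Finite group schemes and their algebras of measures *)

(* A finite group scheme E is given by its coordinate ring k[E], a
   finite-dimensional commutative Hopf algebra. *)
Record finGroupScheme (k : fieldType) := FinGroupScheme {
  coordring : falgType k;
  comul : 'AHom(coordring, tens coordring coordring);
  counit : 'AHom(coordring, k^o);
  antipode : 'AHom(coordring, coordring);
  coordring_comm : commutative (@GRing.mul coordring);
  comulA : forall x,
    tassoc _ _ _ (tmap comul \1%VF (comul x)) = tmap \1%VF comul (comul x);
  counitl : forall x, tlift (fun a b => counit a *: b) (comul x) = x;
  counitr : forall x, tlift (fun a b => counit b *: a) (comul x) = x;
  antipodel : forall x,
    tlift (fun a b => antipode a * b) (comul x) = (counit x)%:A;
  antipoder : forall x,
    tlift (fun a b => a * antipode b) (comul x) = (counit x)%:A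
}.

Section Measures.
Variables (k : fieldType) (E : finGroupScheme k).
Local Notation kE' := (coordring E).

Definition measure_alg := 'Hom(kE', k^o).
HB.instance Definition _ := Vector.on measure_alg.
Implicit Types u v w : measure_alg.

Definition conv u v : measure_alg :=
  linfun (tlift (fun a b => (u a * v b : k^o)) \o comul E).
Definition conv1 : measure_alg := counit E.

Lemma convE u v x : conv u v x = tlift (fun a b => (u a * v b : k^o)) (comul E x).
Proof. by rewrite lfunE. Qed.

Let bl u v : bilin (fun a b => (u a * v b : k^o)).
Proof. exact: bilin_mul. Qed.

Lemma convA : associative conv.
Proof.
move=> u v w; apply/lfunP=> x; rewrite !convE.
pose R (t : tens kE' (tens kE' kE')) : k^o :=
  tlift (fun a s => u a * (tlift (fun b c => (v b * w c : k^o)) s : k^o)) t.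
pose L (t : tens (tens kE' kE') kE') : k^o :=
  tlift (fun s c => (tlift (fun a b => (u a * v b : k^o)) s : k^o) * w c) t.
have blR : bilin (fun (a : kE') (s : tens kE' kE') =>
    (u a * (tlift (fun b c => (v b * w c : k^o)) s : k^o) : k^o)).
  exact: (bilin_mul u (tlift (fun b c => (v b * w c : k^o)))).
have blL : bilin (fun (s : tens kE' kE') (c : kE') =>
    ((tlift (fun a b => (u a * v b : k^o)) s : k^o) * w c : k^o)).
  exact: (bilin_mul (tlift (fun a b => (u a * v b : k^o))) w).
have RD : {morph R : x y / x + y} by move=> x' y'; rewrite /R linearD.
have LD : {morph L : x y / x + y} by move=> x' y'; rewrite /L linearD.
have RL t : R (tassoc _ _ _ t) = L t.
  elim/tens_ind: t => [s t IH1 IH2|s c].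
    by rewrite [tassoc _ _ _ _]linearD RD LD IH1 IH2.
  elim/tens_ind: s => [s t IH1 IH2|a b].
    by rewrite pureDl [tassoc _ _ _ _]linearD RD LD IH1 IH2.
  by rewrite tassocE /R /L !tliftE // mulrA.
have RE t : R (tmap \1%VF (comul E) t) = tlift (fun a b => (u a * conv v w b : k^o)) t.
  elim/tens_ind: t => [s t IH1 IH2|a b].
    by rewrite [tmap _ _ _]linearD RD [RHS]linearD IH1 IH2.
  by rewrite tmapE /R !tliftE // convE id_lfunE.
have LE t : L (tmap (comul E) \1%VF t) = tlift (fun a b => (conv u v a * w b : k^o)) t.
  elim/tens_ind: t => [s t IH1 IH2|a b].
    by rewrite [tmap _ _ _]linearD LD [RHS]linearD IH1 IH2.
  by rewrite tmapE /L !tliftE // convE id_lfunE.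
by rewrite -RE -LE -comulA RL.
Qed.

Lemma conv1l : left_id conv1 conv.
Proof.
move=> u; apply/lfunP=> x; rewrite !convE -{2}(counitl x).
elim/tens_ind: (comul E x) => [s t IH1 IH2|a b]; first by rewrite !linearD /= IH1 IH2.
rewrite !tliftE // ?linearZ //; split=> z c x' y' /=.
  by rewrite linearP scalerDl scalerA.
by rewrite scalerDr !scalerA mulrC.
Qed.

Lemma conv1r : right_id conv1 conv.
Proof.
move=> u; apply/lfunP=> x; rewrite !convE -{2}(counitr x).
elim/tens_ind: (comul E x) => [s t IH1 IH2|a b]; first by rewrite !linearD /= IH1 IH2.
rewrite !tliftE // ?linearZ /= 1?mulrC //; split=> z c x' y' /=.
  by rewrite scalerDr !scalerA mulrC.
by rewrite linearP scalerDl scalerA.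
Qed.

Let tlift_lin (b1 b2 b3 : kE' -> kE' -> k^o) (c : k) :
  (forall x y, b1 x y = c *: b2 x y + b3 x y) ->
  forall t, tlift b1 t = c *: tlift b2 t + tlift b3 t.
Proof.
move=> e t; rewrite /tlift scaler_sumr -big_split; apply: eq_bigr => i _ /=.
rewrite scaler_sumr -big_split; apply: eq_bigr => j _ /=.
by rewrite e scalerDr !scalerA mulrC.
Qed.

Let convPl u v w c : conv (c *: u + v) w = c *: conv u w + conv v w.
Proof.
apply/lfunP=> x; rewrite add_lfunE scale_lfunE !convE; apply: tlift_lin => a b.
by rewrite add_lfunE scale_lfunE mulrDl -scalerAl.
Qed.
Let convPr u v w c : conv u (c *: v + w) = c *: conv u v + conv u w.
Proof.
apply/lfunP=> x; rewrite add_lfunE scale_lfunE !convE; apply: tlift_lin => a b.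
by rewrite add_lfunE scale_lfunE mulrDr -scalerAr.
Qed.

Lemma convDl : left_distributive conv +%R.
Proof. by move=> u v w; have := convPl u v w 1; rewrite !scale1r. Qed.
Lemma convDr : right_distributive conv +%R.
Proof. by move=> u v w; have := convPr u v w 1; rewrite !scale1r. Qed.

Lemma conv1_neq0 : conv1 != 0.
Proof.
apply/eqP=> /lfunP/(_ 1)/eqP; rewrite zero_lfunE.
by have -> : conv1 1 = 1 :> k^o := rmorph1 (counit E); rewrite oner_eq0.
Qed.

HB.instance Definition _ := GRing.Zmodule_isNzRing.Build measure_alg
  convA conv1l conv1r convDl convDr conv1_neq0.

Lemma conv_scaleAl (c : k) u v : c *: (u * v) = (c *: u) * v.
Proof.
have := convPl u 0 v c; rewrite addr0 -[conv 0 v]/(0 * v) mul0r addr0.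
by move/esym.
Qed.
HB.instance Definition _ :=
  GRing.Lmodule_isLalgebra.Build k measure_alg conv_scaleAl.

Lemma conv_scaleAr (c : k) u v : c *: (u * v) = u * (c *: v).
Proof.
have := convPr u v 0 c; rewrite addr0 -[conv u 0]/(u * 0) mulr0 addr0.
by move/esym.
Qed.
HB.instance Definition _ :=
  GRing.Lalgebra_isAlgebra.Build k measure_alg conv_scaleAr.
HB.instance Definition _ := Algebra_isFalgebra.Build k measure_alg.

End Measures.

(** * Constant groups *)

Section ConstantGroup.
Variables (k : fieldType) (G : finZmodType).

Definition gfun := {ffun G -> k^o}.
HB.instance Definition _ := Vector.on gfun.
HB.instance Definition _ := GRing.PzRing.on gfun.
Implicit Types (f : gfun) (g h : G).

Fact gfun1_neq0 : (1 : gfun) != 0.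
Proof. by apply/eqP=> /ffunP/(_ 0)/eqP; rewrite !ffunE oner_eq0. Qed.
HB.instance Definition _ := GRing.PzSemiRing_isNonZero.Build gfun gfun1_neq0.

Fact gfun_scaleAl (c : k) f1 f2 : c *: (f1 * f2) = (c *: f1) * f2.
Proof. by apply/ffunP=> g; rewrite !ffunE scalerAl. Qed.
HB.instance Definition _ := GRing.Lmodule_isLalgebra.Build k gfun gfun_scaleAl.
Fact gfun_scaleAr (c : k) f1 f2 : c *: (f1 * f2) = f1 * (c *: f2).
Proof. by apply/ffunP=> g; rewrite !ffunE scalerAr. Qed.
HB.instance Definition _ := GRing.Lalgebra_isAlgebra.Build k gfun gfun_scaleAr.
HB.instance Definition _ := Algebra_isFalgebra.Build k gfun.

Lemma gfunC : commutative (@GRing.mul gfun).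
Proof. by move=> f1 f2; apply/ffunP=> g; rewrite !ffunE mulrC. Qed.

Definition gdelta g : gfun := [ffun h => (h == g)%:R].

Lemma gfunE f : f = \sum_g f g *: gdelta g.
Proof.
apply/ffunP=> h; rewrite sum_ffunE (bigD1 h) //= !ffunE eqxx big1 ?addr0.
  by rewrite [RHS]mulr1.
by move=> g ne; rewrite !ffunE eq_sym (negPf ne) scaler0.
Qed.

(* (Delta f)(g, h) = f (g + h) *)
Definition gcomul_fun f : tens gfun gfun :=
  \sum_g \sum_h f (g + h) *: pure (gdelta g) (gdelta h).
Definition gcounit_fun f : k^o := f 0.
Definition gantipode_fun f : gfun := [ffun g => f (- g)].

Fact gcomul_linear : linear gcomul_fun.
Proof.
move=> c f1 f2; rewrite /gcomul_fun scaler_sumr -big_split; apply: eq_bigr.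
move=> g _ /=; rewrite scaler_sumr -big_split; apply: eq_bigr => h _ /=.
by rewrite !ffunE scalerDl scalerA.
Qed.
HB.instance Definition _ :=
  GRing.isLinear.Build k gfun (tens gfun gfun) _ gcomul_fun gcomul_linear.

Lemma gdeltaM g h : gdelta g * gdelta h = (g == h)%:R *: gdelta g.
Proof.
apply/ffunP=> x; rewrite !ffunE; have [->|ne] := eqVneq x g.
  by rewrite mul1r [RHS]mulr1.
by rewrite mul0r scaler0.
Qed.

Fact gcomul_monoid_morphism : monoid_morphism gcomul_fun.
Proof.
split=> [|f1 f2].
  have e1 : (1 : gfun) = \sum_g gdelta g.
    by rewrite [LHS]gfunE; apply: eq_bigr => g _; rewrite ffunE scale1r.
  rewrite -[RHS]/(pure (1 : gfun) (1 : gfun)) [in RHS]e1.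
  rewrite pure_suml; apply: eq_bigr => g _.
  rewrite pure_sumr; apply: eq_bigr => h _.
  by rewrite ffunE scale1r.
rewrite /gcomul_fun mulr_suml; apply: eq_bigr => g _; rewrite mulr_suml.
apply: eq_bigr => h _; rewrite mulr_sumr (bigD1 g) //= [X in _ = _ + X]big1 ?addr0.
  rewrite mulr_sumr (bigD1 h) //= [X in _ = _ + X]big1 ?addr0.
    by rewrite -scalerAl -scalerAr pureM !gdeltaM !eqxx !scale1r scalerA !ffunE.
  move=> h' ne; rewrite -scalerAl -scalerAr pureM !gdeltaM (eq_sym h) (negPf ne).
  by rewrite scale0r pure0r !scaler0.
move=> g' ne; rewrite mulr_sumr big1 // => h' _.
rewrite -scalerAl -scalerAr pureM !gdeltaM (eq_sym g) (negPf ne).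
by rewrite scale0r pure0l !scaler0.
Qed.
HB.instance Definition _ := GRing.isMonoidMorphism.Build gfun (tens gfun gfun)
  gcomul_fun gcomul_monoid_morphism.

Fact gcounit_linear : linear gcounit_fun.
Proof. by move=> c f1 f2; rewrite /gcounit_fun !ffunE. Qed.
HB.instance Definition _ :=
  GRing.isLinear.Build k gfun k^o _ gcounit_fun gcounit_linear.
Fact gcounit_monoid_morphism : monoid_morphism gcounit_fun.
Proof. by split=> [|f1 f2]; rewrite /gcounit_fun !ffunE. Qed.
HB.instance Definition _ := GRing.isMonoidMorphism.Build gfun k^o
  gcounit_fun gcounit_monoid_morphism.

Fact gantipode_linear : linear gantipode_fun.
Proof. by move=> c f1 f2; apply/ffunP=> g; rewrite !ffunE. Qed.
HB.instance Definition _ :=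
  GRing.isLinear.Build k gfun gfun _ gantipode_fun gantipode_linear.
Fact gantipode_monoid_morphism : monoid_morphism gantipode_fun.
Proof. by split=> [|f1 f2]; apply/ffunP=> g; rewrite !ffunE. Qed.
HB.instance Definition _ := GRing.isMonoidMorphism.Build gfun gfun
  gantipode_fun gantipode_monoid_morphism.

Definition gcomul : 'AHom(gfun, tens gfun gfun) := linfun_ahom gcomul_fun.
Definition gcounit : 'AHom(gfun, k^o) := linfun_ahom gcounit_fun.
Definition gantipode : 'AHom(gfun, gfun) := linfun_ahom gantipode_fun.

Let comE f : gcomul f = gcomul_fun f. Proof. exact: lfunE. Qed.
Let couE f : gcounit f = f 0. Proof. exact: lfunE. Qed.
Let antE f : gantipode f = [ffun g => f (- g)]. Proof. exact: lfunE. Qed.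

Let tlift_com (Z : vectType k) (b : gfun -> gfun -> Z) f : bilin b ->
  tlift b (gcomul f) = \sum_g \sum_h f (g + h) *: b (gdelta g) (gdelta h).
Proof.
move=> bb; rewrite comE linear_sum; apply: eq_bigr => g _.
by rewrite linear_sum; apply: eq_bigr => h _; rewrite linearZ /= tliftE.
Qed.

Fact gcomulA f :
  tassoc _ _ _ (tmap gcomul \1%VF (gcomul f)) = tmap \1%VF gcomul (gcomul f).
Proof.
pose T a b c : tens gfun (tens gfun gfun) :=
  pure (gdelta a) (pure (gdelta b) (gdelta c)).
transitivity (\sum_a \sum_b \sum_c f (a + b + c) *: T a b c).
  rewrite [tmap _ _ _]lfunE /= tlift_com; last exact: bilin_pure.
  rewrite linear_sum.
  transitivity (\sum_g \sum_h \sum_a \sum_b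
      (f (g + h) * gdelta g (a + b)) *: T a b h).
    apply: eq_bigr => g _; rewrite linear_sum; apply: eq_bigr => h _.
    rewrite linearZ /= comE /gcomul_fun id_lfunE.
    rewrite pure_suml linear_sum scaler_sumr; apply: eq_bigr => a _.
    rewrite pure_suml linear_sum scaler_sumr; apply: eq_bigr => b _ /=.
    by rewrite pureZl linearZ /= tassocE scalerA.
  transitivity (\sum_h \sum_a \sum_b \sum_g
      (f (g + h) * gdelta g (a + b)) *: T a b h).
    rewrite exchange_big; apply: eq_bigr => h _.
    rewrite exchange_big; apply: eq_bigr => a _; exact: exchange_big.
  rewrite exchange_big; apply: eq_bigr => a _.
  rewrite exchange_big; apply: eq_bigr => b _.
  apply: eq_bigr => c _; rewrite (bigD1 (a + b)) //= ffunE eqxx mulr1.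
  by rewrite big1 ?addr0 // => g ne; rewrite ffunE eq_sym (negPf ne) mulr0 scale0r.
symmetry; rewrite [tmap _ _ _]lfunE /= tlift_com; last exact: bilin_pure.
apply: eq_bigr => a _.
transitivity (\sum_h \sum_b \sum_c (f (a + h) * gdelta h (b + c)) *: T a b c).
  apply: eq_bigr => h _; rewrite comE /gcomul_fun id_lfunE.
  rewrite pure_sumr scaler_sumr; apply: eq_bigr => b _.
  rewrite pure_sumr scaler_sumr; apply: eq_bigr => c _.
  by rewrite pureZr scalerA.
rewrite exchange_big; apply: eq_bigr => b _.
rewrite exchange_big; apply: eq_bigr => c _.
rewrite (bigD1 (b + c)) //= ffunE eqxx mulr1 addrA.
by rewrite big1 ?addr0 // => g ne; rewrite ffunE eq_sym (negPf ne) mulr0 scale0r.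
Qed.

Fact gcounitl f : tlift (fun a b => gcounit a *: b) (gcomul f) = f.
Proof.
rewrite tlift_com; last first.
  split=> z c x y; first by rewrite linearP scalerDl scalerA.
  by rewrite scalerDr !scalerA mulrC.
rewrite (bigD1 0) //= [X in _ + X = _]big1 ?addr0.
  rewrite [RHS]gfunE; apply: eq_bigr => h _.
  by rewrite couE ffunE eqxx scale1r add0r.
move=> g ne; apply: big1 => h _.
by rewrite couE ffunE eq_sym (negPf ne) scale0r scaler0.
Qed.

Fact gcounitr f : tlift (fun a b => gcounit b *: a) (gcomul f) = f.
Proof.
rewrite tlift_com; last first.
  split=> z c x y; last by rewrite linearP scalerDl scalerA.
  by rewrite scalerDr !scalerA mulrC.
rewrite [RHS]gfunE; apply: eq_bigr => g _; rewrite (bigD1 0) //=.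
rewrite [X in _ + X = _]big1 ?addr0; first by rewrite couE ffunE eqxx scale1r.
move=> h ne; by rewrite couE ffunE eq_sym (negPf ne) scale0r scaler0.
Qed.

Fact gantipodel f :
  tlift (fun a b => gantipode a * b) (gcomul f) = (gcounit f)%:A.
Proof.
rewrite tlift_com; last first.
  exact: (bilin_mul gantipode (idfun : {linear gfun -> gfun})).
apply/ffunP=> x; rewrite couE !ffunE sum_ffunE (bigD1 (- x)) //= [X in _ + X = _]big1.
  rewrite addr0 sum_ffunE (bigD1 x) //= [X in _ + X = _]big1.
    by rewrite addr0 antE !ffunE !eqxx mulr1 addNr.
  by move=> h ne; rewrite !ffunE (eq_sym x) (negPf ne) mulr0 scaler0.
move=> g ne; rewrite sum_ffunE big1 // => h _.
by rewrite antE !ffunE (eq_sym (- x)) (negPf ne) mul0r scaler0.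
Qed.

Fact gantipoder f :
  tlift (fun a b => a * gantipode b) (gcomul f) = (gcounit f)%:A.
Proof.
rewrite tlift_com; last first.
  exact: (bilin_mul (idfun : {linear gfun -> gfun}) gantipode).
apply/ffunP=> x; rewrite couE !ffunE sum_ffunE (bigD1 x) //= [X in _ + X = _]big1.
  rewrite addr0 sum_ffunE (bigD1 (- x)) //= [X in _ + X = _]big1.
    by rewrite addr0 antE !ffunE !eqxx mulr1 addrN.
  by move=> h ne; rewrite antE !ffunE (eq_sym (- x)) (negPf ne) mulr0 scaler0.
move=> g ne; rewrite sum_ffunE big1 // => h _.
by rewrite !ffunE (eq_sym x) (negPf ne) mul0r scaler0.
Qed.

Definition constant_group : finGroupScheme k :=
  FinGroupScheme gfunC gcomulA gcounitl gcounitr gantipodel gantipoder.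

End ConstantGroup.

(** * Truncated polynomial algebras and Frobenius kernels of G_a *)

(* k[T]/(T^N), for N > 0 *)
Definition tpoly (k : fieldType) (N : nat) := {poly %/ ('X^N : {poly k})}.
HB.instance Definition _ (k : fieldType) N :=
  GRing.ComUnitAlgebra.on (tpoly k N).
HB.instance Definition _ (k : fieldType) N := Vector.copy (tpoly k N)
  {poly_(size (mk_monic ('X^N : {poly k}))).-1 k}.

Definition tvar (k : fieldType) N : tpoly k N := 'qX.

Section TPoly.
Variables (k : fieldType) (N : nat).
Hypothesis N_gt0 : (0 < N)%N.

Let mkE : mk_monic ('X^N : {poly k}) = 'X^N.
Proof. by rewrite mk_monic_Xn prednK. Qed.

Lemma tpolyE (f : tpoly k N) :
  f = \sum_(i < size (f : {poly k})) (f : {poly k})`_i *: tvar k N ^+ i.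
Proof.
have -> : tvar k N = in_qpoly 'X^N 'X by [].
rewrite (eq_bigr (fun i : 'I__ => in_qpoly 'X^N ((f : {poly k})`_i *: 'X^i))).
  rewrite -linear_sum /= -poly_def coefK.
  by apply: val_inj; rewrite /= Pdiv.CommonRing.rmodp_small // size_mk_monic.
by move=> i _; rewrite linearZ rmorphXn.
Qed.

Lemma tpoly_ind (P : tpoly k N -> Prop) : P 1 -> P (tvar k N) ->
  (forall x y, P x -> P y -> P (x * y)) ->
  (forall c x y, P x -> P y -> P (c *: x + y)) -> forall x, P x.
Proof.
move=> P1 PX PM PL x.
have P0 : P 0.
  have := PL (-1) 1 1 P1 P1; by rewrite scaleN1r addNr.
have PXn i : P (tvar k N ^+ i).
  by elim: i => [|i IH]; rewrite ?expr0 // exprS; apply: PM.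
rewrite [x]tpolyE; apply: (big_ind P) => // [y z Py Pz|i _].
  by rewrite -[y]scale1r; apply: PL.
by rewrite -[_ *: _]addr0; apply: PL.
Qed.

Lemma tvarXN : tvar k N ^+ N = 0.
Proof.
apply: val_inj; rewrite -[tvar k N]/(in_qpoly 'X^N 'X) -rmorphXn /=.
by rewrite mkE -Pdiv.IdomainMonic.modpE ?monicXn // modpp.
Qed.

(* The algebra map k[T]/(T^N) -> B with T |-> z, provided z^N = 0. *)
Definition tpoly_eval_fun (B : falgType k) (z : B) (f : tpoly k N) : B :=
  horner_alg z (f : {poly k}).

Section Eval.
Variables (B : falgType k) (z : B).
Hypothesis zN : z ^+ N = 0.

Let evalE (q : {poly k}) : tpoly_eval_fun z (in_qpoly 'X^N q) = horner_alg z q.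
Proof.
rewrite /tpoly_eval_fun /= mkE -Pdiv.IdomainMonic.modpE ?monicXn //.
rewrite [in RHS](divp_eq q 'X^N) rmorphD rmorphM rmorphXn /=.
by rewrite horner_algX zN mulr0 add0r.
Qed.

Fact tpoly_eval_linear : linear (tpoly_eval_fun z : tpoly k N -> B).
Proof. 
move=> c x y; rewrite /tpoly_eval_fun.
have -> : (c *: x + y : tpoly k N) = c *: (x : {poly k}) + y :> {poly k} by [].
by rewrite linearD linearZ /= -scalerAl mul1r.
Qed.
HB.instance Definition _ := GRing.isLinear.Build k (tpoly k N) B _
  (tpoly_eval_fun z : tpoly k N -> B) tpoly_eval_linear.

Fact tpoly_eval_ahom :
  ahom_in {:tpoly k N} (linfun (tpoly_eval_fun z : tpoly k N -> B)).
Proof.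
apply/ahomP_tmp; split=> [|x y]; rewrite !lfunE /=.
  by rewrite /tpoly_eval_fun rmorph1.
by rewrite -[x * y]/(in_qpoly 'X^N ((x : {poly k}) * y)) evalE rmorphM.
Qed.
Definition tpoly_eval : 'AHom(tpoly k N, B) := AHom tpoly_eval_ahom.

Lemma tpoly_evalX : tpoly_eval (tvar k N) = z.
Proof. by rewrite lfunE /= -[tvar k N]/(in_qpoly 'X^N 'X) evalE horner_algX. Qed.
End Eval.
End TPoly.

Section FrobeniusKernel.
Variables (k : fieldType) (p : nat) (pchar_k : p \in [pchar k]) (r : nat).
Local Notation N := (p ^ r)%N.
Local Notation A := (tpoly k N).
Local Notation T := (tvar k N).

Let N_gt0 : (0 < N)%N.
Proof. by rewrite expn_gt0 prime_gt0 ?(pcharf_prime pchar_k). Qed.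

(* Delta T = T (x) 1 + 1 (x) T,  epsilon T = 0,  S T = - T *)
Definition Ga_comulX : tens A A := pure T 1 + pure 1 T.

Fact Ga_comulX_nilp : Ga_comulX ^+ N = 0.
Proof.
have pcharAA : p \in [pchar tens A A].
  apply/andP; split; first exact: pcharf_prime pchar_k.
  by rewrite -(scaler_nat p (1 : tens A A)) (pcharf0 pchar_k) scale0r.
have com : GRing.comm (pure T 1 : tens A A) (pure 1 T).
  by rewrite /GRing.comm !pureM !mul1r !mulr1.
have pn (a b : A) i : (pure a b : tens A A) ^+ i = pure (a ^+ i) (b ^+ i).
  by elim: i => [|i IH]; rewrite ?expr0 // !exprS IH pureM.
have frob i (x y : tens A A) : GRing.comm x y ->
    (x + y) ^+ (p ^ i) = x ^+ (p ^ i) + y ^+ (p ^ i).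
  move=> cxy; elim: i => [|i IH]; first by rewrite !expr1.
  rewrite expnSr !exprM IH -!(pFrobenius_autE pcharAA) pFrobenius_autD_comm //.
  by apply: commrX; apply: commr_sym; apply: commrX; apply: commr_sym.
by rewrite frob // !pn tvarXN // expr1n pure0l pure0r addr0.
Qed.

Fact Ga_counitX_nilp : (0 : k^o) ^+ N = 0.
Proof. by rewrite expr0n; case: N N_gt0. Qed.

Fact Ga_antipodeX_nilp : (- T) ^+ N = 0 :> A.
Proof. by rewrite exprNn tvarXN // mulr0. Qed.

Definition Ga_comul : 'AHom(A, tens A A) := tpoly_eval N_gt0 Ga_comulX_nilp.
Definition Ga_counit : 'AHom(A, k^o) := tpoly_eval N_gt0 Ga_counitX_nilp.
Definition Ga_antipode : 'AHom(A, A) := tpoly_eval N_gt0 Ga_antipodeX_nilp.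

Let comX : Ga_comul T = pure T 1 + pure 1 T. Proof. exact: tpoly_evalX. Qed.
Let couX : Ga_counit T = 0. Proof. exact: tpoly_evalX. Qed.
Let antX : Ga_antipode T = - T. Proof. exact: tpoly_evalX. Qed.
Let com1 : Ga_comul 1 = pure 1 1. Proof. exact: rmorph1. Qed.
Let AC : commutative (@GRing.mul A). Proof. exact: mulrC. Qed.

Fact Ga_comulA x : tassoc _ _ _ (tmap Ga_comul \1%VF (Ga_comul x)) =
  tmap \1%VF Ga_comul (Ga_comul x).
Proof.
elim/tpoly_ind: x => [||x y Px Py|c x y Px Py].
- by rewrite com1 !tmapE !id_lfunE com1 tassocE.
- rewrite comX !linearD /= !tmapE !id_lfunE com1 comX.
  by rewrite pureDl pureDr !linearD /= !tassocE addrA.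
- have tmapl := tmapM Ga_comul \1%AF; have tmapr := tmapM \1%AF Ga_comul.
  by rewrite rmorphM /= tmapl tmapr tassocM Px Py.
- by rewrite !linearP /= Px Py.
Qed.

Let pairP (f g : {lrmorphism A -> A}) (h : {lrmorphism A -> A}) :
  f T + g T = h T ->
  forall x, tlift (fun a b => f a * g b) (Ga_comul x) = h x.
Proof.
move=> e x; have bl := bilin_mul f g.
elim/tpoly_ind: x => [||x y Px Py|c x y Px Py].
- by rewrite com1 tliftE // !rmorph1 mulr1.
- by rewrite comX linearD /= !tliftE // !rmorph1 mulr1 mul1r.
- by rewrite rmorphM /= tpairM // Px Py rmorphM.
- by rewrite !linearP /= Px Py.
Qed.

Let zN : (0 : A) ^+ N = 0. Proof. by rewrite expr0n; case: N N_gt0. Qed.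
Let U : 'AHom(A, A) := tpoly_eval N_gt0 zN.
Let UX : U T = 0. Proof. exact: tpoly_evalX. Qed.
Let UE x : (Ga_counit x)%:A = U x.
Proof.
elim/tpoly_ind: x => [||x y Px Py|c x y Px Py].
- by rewrite !rmorph1 scale1r.
- by rewrite couX UX scale0r.
- by rewrite !rmorphM /= -Px -Py -scalerAl mul1r scalerA.
- by rewrite !linearP /= -Px -Py scalerDl scalerA.
Qed.

Let tlift_eq (b1 b2 : A -> A -> A) t : b1 =2 b2 -> tlift b1 t = tlift b2 t.
Proof.
by move=> e; apply: eq_bigr => i _; apply: eq_bigr => j _; rewrite e.
Qed.

Fact Ga_counitl x : tlift (fun a b => Ga_counit a *: b) (Ga_comul x) = x.
Proof.
have e : U T + T = T by rewrite UX add0r.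
rewrite -[RHS](@pairP U idfun idfun e).
by apply: tlift_eq => a b /=; rewrite -UE -scalerAl mul1r.
Qed.

Fact Ga_counitr x : tlift (fun a b => Ga_counit b *: a) (Ga_comul x) = x.
Proof.
have e : T + U T = T by rewrite UX addr0.
rewrite -[RHS](@pairP idfun U idfun e).
by apply: tlift_eq => a b /=; rewrite -UE -scalerAr mulr1.
Qed.

Fact Ga_antipodel x :
  tlift (fun a b => Ga_antipode a * b) (Ga_comul x) = (Ga_counit x)%:A.
Proof.
have e : Ga_antipode T + T = U T by rewrite antX UX addNr.
by rewrite UE -[RHS](@pairP Ga_antipode idfun U e).
Qed.

Fact Ga_antipoder x :
  tlift (fun a b => a * Ga_antipode b) (Ga_comul x) = (Ga_counit x)%:A.
Proof.
have e : T + Ga_antipode T = U T by rewrite antX UX addrN.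
by rewrite UE -[RHS](@pairP idfun Ga_antipode U e).
Qed.

Definition Ga_kernel : finGroupScheme k :=
  FinGroupScheme AC Ga_comulA Ga_counitl Ga_counitr Ga_antipodel Ga_antipoder.

End FrobeniusKernel.

(** * Elementary abelian group schemes *)

Section GroupSchemes.
Variable k : fieldType.
Implicit Types G H E : finGroupScheme k.

(* Homomorphisms G -> H are given by their comorphisms k[H] -> k[G]. *)
Definition group_hom G H (phi : 'AHom(coordring H, coordring G)) :=
  forall x, comul G (phi x) = tmap phi phi (comul H x).

Definition closed_embedding G H (phi : 'AHom(coordring H, coordring G)) :=
  group_hom phi /\ limg phi = fullv.

Definition isomorphic G H :=
  exists2 phi : 'AHom(coordring H, coordring G), group_hom phi & bijective phi.

Definition abelian_scheme E :=
  forall x, tlift (fun a b => pure b a) (comul E x) = comul E x.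

Definition pushforward G H (phi : 'AHom(coordring H, coordring G)) :
  'Hom(measure_alg G, measure_alg H) :=
  linfun (fun u : measure_alg G => (u \o phi)%VF : measure_alg H).

Lemma pushforwardE G H (phi : 'AHom(coordring H, coordring G)) u x :
  pushforward phi u x = u (phi x).
Proof.
have lin : linear (fun u : measure_alg G => (u \o phi)%VF : measure_alg H).
  by move=> c v w; apply/lfunP=> y; rewrite !(comp_lfunE, add_lfunE, scale_lfunE).
pose F : {linear measure_alg G -> measure_alg H} :=
  HB.pack (fun u : measure_alg G => (u \o phi)%VF : measure_alg H)
    (GRing.isLinear.Build k (measure_alg G) (measure_alg H) _ _ lin).
by rewrite (lfunE F) /= comp_lfunE.
Qed.

(* E = E_1 ... E_n: the product morphism E_1 x ... x E_n -> E is an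
   epimorphism, i.e. the induced map kE_1 (x) ... (x) kE_n -> kE, whose image
   is the product of the subspaces kE_i of kE, is onto. *)
Definition product_of_subgroups E n (G : 'I_n -> finGroupScheme k)
    (iota : forall i, 'AHom(coordring E, coordring (G i))) :=
  (forall i, closed_embedding (iota i)) /\
  (\big[@prodv k (measure_alg E)/1%VS]_(i < n) limg (pushforward (iota i)))%VS
    = fullv.

Definition elementary_abelian (p : nat) (pchar_k : p \in [pchar k]) E :=
  abelian_scheme E /\
  exists n (G : 'I_n -> finGroupScheme k)
         (iota : forall i, 'AHom(coordring E, coordring (G i))),
    (forall i, (exists r, isomorphic (G i) (Ga_kernel pchar_k r)) \/
               isomorphic (G i) (constant_group k 'Z_p)) /\
    product_of_subgroups iota.

(* A ~ k[X_1, ..., X_n]/(X_1^p, ..., X_n^p) *)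
Definition truncated_presentation (A : falgType k) (p n : nat) :=
  exists2 phi : {lrmorphism {mpoly k[n]} -> A}, (forall y, exists f, phi f = y) &
    forall f, phi f = 0 <->
      exists g : 'I_n -> {mpoly k[n]}, f = \sum_(i < n) g i * 'X_i ^+ p.

Definition abelian_unipotent_rank (p : nat) E (n : nat) :=
  truncated_presentation (measure_alg E) p n.

End GroupSchemes.

(** * The Jacobson radical *)

Section Radical.
Variables (k : fieldType) (A : falgType k).
Implicit Types I J : {vspace A}.

Definition left_ideal I := (fullv * I <= I)%VS.
Definition maximal_left_ideal I :=
  [/\ left_ideal I, I != fullv &
      forall J, left_ideal J -> (I <= J)%VS -> J = I \/ J = fullv].

Definition in_all_maximal (x : A) := forall I, maximal_left_ideal I -> x \in I.

Lemma radical_exists : exists J : {vspace A}, forall x, x \in J <-> in_all_maximal x.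
Proof.
suff shrink n (J : {vspace A}) : (\dim J <= n)%N ->
    (forall x, in_all_maximal x -> x \in J) ->
    exists J : {vspace A}, forall x, x \in J <-> in_all_maximal x.
  by apply: (shrink _ fullv (leqnn _)) => x _; apply: memvf.
elim: n J => [|n IH] J dJ JP.
  exists J => x; split; last exact: JP.
  by move: dJ; rewrite leqn0 dimv_eq0 memvE => /eqP ->; rewrite -memvE memv0
    => /eqP -> I _; apply: mem0v.
have [Jmin|/not_all_ex_not[I]] :=
  classic (forall I, maximal_left_ideal I -> (J <= I)%VS).
  by exists J => x; split=> [xJ I /Jmin/subvP|]; [apply | apply: JP].
move=> nI; have [maxI nJI] := imply_to_and _ _ nI.
apply: (IH (J :&: I)%VS) => [|x xP].
  rewrite -ltnS (leq_trans _ dJ) // ltn_neqAle dimvS ?capvSl // andbT.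
  apply/negP=> /eqP eqd; case: nJI; apply/capv_idPl/eqP.
  by rewrite eqEdim capvSl eqd leqnn.
by rewrite memv_cap (JP x xP) (xP I maxI).
Qed.

Definition Rad : {vspace A} :=
  proj1_sig (constructive_indefinite_description _ radical_exists).

Lemma RadP x : x \in Rad <-> in_all_maximal x.
Proof. by rewrite /Rad; case: constructive_indefinite_description. Qed.

End Radical.

Arguments Rad {k} A.

(** * p-points and modules of constant j-rank *)

Definition projective (R : nzRingType) (P : lmodType R) :=
  forall (M N : lmodType R) (g : {linear M -> N}) (f : {linear P -> N}),
    (forall y, exists x, g x = y) ->
    exists h : {linear P -> M}, forall x, g (h x) = f x.

Definition restr (k : fieldType) (A B : falgType k) (alpha : 'AHom(A, B)) : Type
  := B.

Section Restriction.
Variables (k : fieldType) (A B : falgType k) (alpha : 'AHom(A, B)).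
HB.instance Definition _ := GRing.Zmodule.copy (restr alpha) B.

Definition restr_scale (a : A) (x : restr alpha) : restr alpha :=
  alpha a * (x : B).

Fact restr_scaleA a b x :
  restr_scale a (restr_scale b x) = restr_scale (a * b) x.
Proof. by rewrite /restr_scale rmorphM mulrA. Qed.
Fact restr_scale1 : left_id 1 restr_scale.
Proof. by move=> x; rewrite /restr_scale rmorph1 mul1r. Qed.
Fact restr_scaleDr : right_distributive restr_scale +%R.
Proof. by move=> a x y; apply: mulrDr. Qed.
Fact restr_scaleDl x : {morph restr_scale^~ x : a b / a + b}.
Proof. by move=> a b; rewrite /restr_scale rmorphD; apply: mulrDl. Qed.

HB.instance Definition _ := GRing.Zmodule_isLmodule.Build A (restr alpha)
  restr_scaleA restr_scale1 restr_scaleDr restr_scaleDl.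

End Restriction.

Record fdmodule (k : fieldType) (A : falgType k) := FdModule {
  mcarrier :> vectType k;
  act : 'Hom(A, 'End(mcarrier));
  act1 : act 1 = \1%VF;
  actM : forall a b, act (a * b) = (act a \o act b)%VF
}.
Arguments act {k A} M : rename.

Section PPoints.
Variables (k : fieldType) (p : nat) (A : falgType k).

Definition p_point (alpha : 'AHom(tpoly k p, A)) := projective (restr alpha).

Variables (M : fdmodule A) (j : nat).

(* u_M^j *)
Definition act_pow (u : A) : 'End(M) := iter j (fun f => (act M u \o f)%VF) \1%VF.

Definition rank_at (alpha : 'AHom(tpoly k p, A)) : nat :=
  \dim (limg (act_pow (alpha (tvar k p)))).

Definition is_rank (r : nat) := exists2 alpha, p_point alpha & rank_at alpha = r.

(* The maximum is 0 when there are no p-points, e.g. for A = k. *)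
Definition jrank : nat :=
  \max_(r < (\dim {:M}).+1 | excluded_middle_informative (is_rank r)) r.

Definition constant_jrank :=
  forall alpha, p_point alpha -> rank_at alpha = jrank.

End PPoints.

Arguments jrank {k} p {A} M j.
Arguments constant_jrank {k} p {A} M j.

(** * Projective spaces, homogeneous morphisms and their degrees *)

Section Projective.
Variables (k : fieldType) (L : vectType k).
Implicit Types (W : {vspace L}).

(* Points of projective spaces are lines; [u] is <[u]>%VS. *)
Definition proj_space W (l : {vspace L}) := \dim l = 1%N /\ (l <= W)%VS.

Variable L' : vectType k.

Definition poly_point W (f : 'I_(\dim {:L'}) -> {mpoly k[\dim W]}) (x : L) : L' :=
  \sum_i (f i).@[fun a => coord (vbasis W) a x] *: ebasis i.

(* phi, defined on the subset X of P(W), is given by the homogeneous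
   polynomials f_i of degree d, which have no common zero on X. *)
Definition represents W (X : {vspace L} -> Prop) (phi : {vspace L} -> {vspace L'})
    (d : nat) (f : 'I_(\dim {:L'}) -> {mpoly k[\dim W]}) :=
  (forall i, f i \is d.-homog) /\
  forall x, x != 0 -> X <[x]>%VS ->
    poly_point f x != 0 /\ phi <[x]>%VS = <[poly_point f x]>%VS.

(* Such a map is automatically a morphism of varieties. *)
Definition homogeneous W X phi := exists d f, @represents W X phi d f.

Definition gcd_is_1 (I : Type) n (f : I -> {mpoly k[n]}) :=
  forall g, (forall i, exists h, f i = h * g) -> exists2 c, c != 0 & g = c%:MP.

Definition is_degree W X phi d :=
  exists2 f, @represents W X phi d f & gcd_is_1 f.

(* Meaningful for W != 0 and X a non-empty open subset of P(W), where
   is_degree holds for a unique d if phi is a morphism. *)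
Definition degree W X phi : nat := epsilon (inhabits 0%N) (is_degree W X phi).

End Projective.

(** * Grassmannians and the Pluecker embedding *)

Section Grassmannian.
Variables (k : fieldType) (M : vectType k) (d : nat).

Definition Gr (W : {vspace M}) := \dim W = d.

Definition incr_seq (m : nat) :=
  {s : {ffun 'I_d -> 'I_m} | [forall a : 'I_d, forall b : 'I_d, (a < b)%N ==> (s a < s b)%N]}.

(* Coordinates with respect to the basis e_(s 0) /\ ... /\ e_(s (d - 1)),
   s increasing *)
Definition ext_power := {ffun incr_seq (\dim {:M}) -> k^o}.
HB.instance Definition _ := Vector.on ext_power.

(* w_0 /\ ... /\ w_(d - 1) *)
Definition wedge (w : 'I_d -> M) : ext_power :=
  [ffun s : incr_seq (\dim {:M}) =>
     \det (\matrix_(a < d, b < d) ecoord (val s b) (w a)) : k^o].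

Definition pluecker (W : {vspace M}) : {vspace ext_power} :=
  <[wedge (fun a => (vbasis W)`_a)]>%VS.

End Grassmannian.

Arguments pluecker {k M} d W.

(** * The morphism Im^j_M *)

Section ImageMap.
Variables (k : fieldType) (A : falgType k) (M : fdmodule A) (j : nat).

Definition U_space (l : {vspace A}) :=
  proj_space (Rad A) l /\ ~~ (l <= Rad A * Rad A)%VS.

Definition Im_map (l : {vspace A}) : {vspace M} := limg (act_pow M j (vpick l)).

(* Im_map does not depend on the representative. *)
Lemma Im_mapE u : u != 0 -> Im_map <[u]> = limg (act_pow M j u).
Proof.
move=> u0; have /vlineP[c vE] := memv_pick <[u]>%VS.
have c0 : c != 0.
  have : vpick <[u]>%VS != 0 by rewrite vpick0 -dimv_eq0 dim_vline u0.
  by rewrite vE; apply: contraNneq => ->; rewrite scale0r.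
have -> : Im_map <[u]> = limg (c ^+ j *: act_pow M j u).
  rewrite /Im_map vE /act_pow linearZ /=; congr (lfun_img _ _).
  elim: j => [|i IH]; first by rewrite scale1r.
  by rewrite !iterS IH -comp_lfunZl -comp_lfunZr scalerA exprS.
apply/eqP; rewrite eqEsubv; apply/andP; split; apply/subvP=> _ /memv_imgP[x _ ->].
  by rewrite scale_lfunE memvZ // memv_img ?memvf.
rewrite -[_ x](scalerK (expf_neq0 j c0)) -scale_lfunE memvZ // memv_img //.
exact: memvf.
Qed.

End ImageMap.

Arguments U_space {k} A l.

(* Main.v *)
Require Import Defs.
From HB Require Import structures.
From mathcomp Require Import all_boot all_order all_algebra all_field.
From mathcomp Require Import perm.
From mathcomp.multinomials Require Import mpoly.
From Stdlib Require Import ClassicalEpsilon.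

Set Implicit Arguments.
Unset Strict Implicit.
Unset Printing Implicit Defensive.

Import GRing.Theory.
Local Open Scope ring_scope.

(* Write A = kE, I for the augmentation ideal.  An element c of k[E] with
   Delta c = c (x) 1 + 1 (x) c acts on A = k[E]^* as a derivation.  For the
   Frobenius kernels this yields u^p = eps(u)^p for every u, which then holds on
   all of A, so that Rad A = I.  For u in I \ I^2 some such c gives a derivation D
   with D u invertible, without loss of generality D u = 1; since
   sum_i u^i D^(p-1) u^(p-1-i) = (p-1)!, Higman's criterion shows that u is a
   p-point.  Hence u_M^j has constant rank d on I \ I^2.

   The vectors (u_M^j m_1) /\ ... /\ (u_M^j m_d), for m_i in a basis of M, are
   tuples of forms in u which are all proportional.  Polynomial rings being
   factorial, they are multiples of one tuple of forms, which therefore has no zero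
   on U and represents Im^j.

   If dim V >= 2, a common factor of such a tuple has no zero on P(V), hence is
   constant.  Two representations of the same map without zeros on a projective
   line contained in P(V) are proportional there, hence have the same degree. *)

(** * Contents of polynomials *)

Section Contents.

Local Notation widen := (widen_ord (leqnSn _)).

(** The hypothesis on [M] constrains ranks at p-points only, and p-points are defined by
    projectivity; this is why Higman's criterion enters. Its input comes from the Weyl relation
    [[D, u] = 1]: commuting with [u] turns [D^m] into [m D^(m-1)], so p - 1 commutators reduce
    [D^(p-1)] to a nonzero scalar. In characteristic p the coefficients of this iterated commutator
    are all 1, which makes it a relative trace. The obstacle in (1) is that each single wedge may
    vanish somewhere on U, so no choice of columns works everywhere. Only the common row factor
    does, and extracting it over a polynomial ring needs contents. In (2), a coprime tuple could
    acquire a common factor when restricted to P(V). This is excluded because a nonconstant form in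
    at least two variables has a nontrivial zero; on a single point, powers of the coordinate would
    escape the argument. Identities are known on U only; they are spread to the whole space along
    lines that meet the complement of U in at most one relevant point. *)

Definition divides (D : comNzRingType) (c a : D) := exists b, a = b * c.

(* The gcd of the family is 1, in the strong sense that this remains true
   after multiplying the family by any a. *)
Definition primitive_family (D : comNzRingType) (I : Type) (f : I -> D) :=
  forall a c, (forall i, divides c (a * f i)) -> divides c a.

Definition has_contents (D : comNzRingType) :=
  forall (I : finType) (f : I -> D), (exists i, f i != 0) ->
  exists g f', primitive_family f' /\ forall i : I, f i = g * f' i.

Lemma dividesD (D : comNzRingType) (c a b : D) :
  divides c a -> divides c b -> divides c (a + b).
Proof. by move=> [x ->] [y ->]; exists (x + y); rewrite mulrDl. Qed.

Lemma divides_mull (D : comNzRingType) (c a b : D) :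
  divides c a -> divides c (b * a).
Proof. by move=> [x ->]; exists (b * x); rewrite mulrA. Qed.

Lemma dividesN (D : comNzRingType) (c a : D) : divides c a -> divides c (- a).
Proof. by move=> [x ->]; exists (- x); rewrite mulNr. Qed.

Lemma divides0 (D : comNzRingType) (c : D) : divides c 0.
Proof. by exists 0; rewrite mul0r. Qed.

Lemma divides_sum (D : comNzRingType) (c : D) (J : Type) (r : seq J) (P : pred J) F :
  (forall i, P i -> divides c (F i)) -> divides c (\sum_(i <- r | P i) F i).
Proof. by move=> cF; apply: big_ind => //; [exact: divides0|exact: dividesD]. Qed.

Lemma divides_polyC (D : comNzRingType) (c : D) (q : {poly D}) :
  (forall n, divides c q`_n) -> divides c%:P q.
Proof.
move=> cq; pose b n := proj1_sig (constructive_indefinite_description _ (cq n)).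
have bE n : q`_n = b n * c by rewrite /b; case: constructive_indefinite_description.
exists (\poly_(n < size q) b n); apply/polyP=> n; rewrite coefMC coef_poly.
by case: ltnP => [_|ge]; rewrite ?bE // mul0r -bE nth_default.
Qed.

Lemma divides_coef (D : comNzRingType) (c : D) (q : {poly D}) n :
  divides c%:P q -> divides c q`_n.
Proof. by move=> [b ->]; exists b`_n; rewrite coefMC. Qed.

(** Gauss's lemma without prime elements. The coefficients of the [r i] being jointly primitive, it
    is enough that [c] divides [q] times each of them. This goes by descending induction on the
    degree [n] of the coefficient: its product with the leading coefficient of [q] is isolated in
    degree [s + n]; then the leading term can be removed and the induction on [size q] applies. *)
Lemma gauss_contents (D : comNzRingType) (I : Type) (r : I -> {poly D}) c q :
  primitive_family (fun x : I * nat => (r x.1)`_x.2) ->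
  (forall i, divides c%:P (q * r i)) -> divides c%:P q.
Proof.
move=> prim; have [m] := ubnP (size q); elim: m q => // m IH q sq cqr.
have [->|q0] := eqVneq q 0; first exact: divides0.
suff crq i n : divides c%:P ((r i)`_n *: q).
  apply: divides_polyC => l; apply: prim => -[i n] /=.
  by rewrite mulrC -coefZ; apply: divides_coef.
have [l le_l] := ubnP (size (r i) - n)%N; elim: l n le_l => // l IHl n le_l.
have [le|lt_n] := leqP (size (r i)) n.
  by rewrite nth_default // scale0r; apply: divides0.
set s := (size q).-1.
have ctop : divides c ((r i)`_n * q`_s).
  have := divides_coef (s + n) (cqr i).
  rewrite coefM (bigD1 (inord s)) //= inordK ?ltnS ?leq_addr //.
  rewrite addKn => top.
  move: top; set S := \sum_(a < _ | _) _ => top.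
  have -> : (r i)`_n * q`_s = q`_s * (r i)`_n + S - S by rewrite addrK mulrC.
  apply: dividesD => //; apply: dividesN.
  apply: divides_sum => a ne.
  have {}ne : nat_of_ord a != s.
    by apply: contraNneq ne => e; apply/eqP/val_inj; rewrite /= inordK ?ltnS ?leq_addr.
  have [lt|ge] := ltnP s a.
    rewrite nth_default; first by rewrite mul0r; apply: divides0.
    by rewrite -(prednK (n := size q)) ?size_poly_gt0.
  have lta : (a < s)%N by rewrite ltn_neqAle ne.
  have gtn : (n < s + n - a)%N by rewrite ltn_subRL addnC addnC ltn_add2r.
  rewrite mulrC -coefZ; apply: divides_coef; apply: IHl.
  have := ltn_sub2l lt_n gtn; move: le_l; rewrite ltnS => /[swap] /leq_trans h.
  by move/h; apply.
have -> : (r i)`_n *: q = ((r i)`_n *: q - ((r i)`_n * q`_s) *: 'X^s)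
    + ((r i)`_n * q`_s) *: 'X^s by rewrite subrK.
apply: dividesD; last first.
  by rewrite -mul_polyC mulrC; apply: divides_mull; case: ctop => b ->;
     exists b%:P; rewrite polyCM.
apply: IH.
  have sq1 : size q = s.+1 by rewrite prednK ?size_poly_gt0.
  move: sq; rewrite sq1 ltnS => lem; apply: leq_trans lem; rewrite ltnS.
  apply/leq_sizeP => e; rewrite leq_eqVlt => /orP[/eqP <-|lt].
    by rewrite coefB !coefZ coefXn eqxx mulr1 subrr.
  rewrite coefB !coefZ coefXn gtn_eqF // mulr0 subr0 [q`_e]nth_default ?mulr0 //.
  by rewrite sq1.
move=> i'; rewrite mulrBl -!scalerAl; apply: dividesD.
  by rewrite -mul_polyC; apply: divides_mull.
apply: dividesN; rewrite -mul_polyC mulrC; apply: divides_mull.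
by case: ctop => b ->; exists b%:P; rewrite polyCM.
Qed.

(* Bezout over the fraction field, with denominators cleared. *)
Lemma pseudo_principal (D : idomainType) (I : finType) (F : I -> {poly D}) :
  (exists i, F i != 0) ->
  exists r a, [/\ r != 0, r = \sum_i a i * F i &
    exists2 c, c != 0 & forall i, divides r (c%:P * F i)].
Proof.
move=> [i0 Fi0]; pose inI x := exists a : I -> {poly D}, x = \sum_i a i * F i.
have inF i : inI (F i).
  exists (fun l => (l == i)%:R); rewrite (bigD1 i) //= eqxx mul1r big1 ?addr0 //.
  by move=> l /negPf ->; rewrite mul0r.
have [r [[a ra] r0 rmin]] :
    exists r, [/\ inI r, r != 0 & forall x, inI x -> (size x < size r)%N -> x = 0].
  have [m] := ubnP (size (F i0)); elim: m (F i0) Fi0 (inF i0) => // m IH x x0 xI lex.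
  have [xmin|] := classic (forall y, inI y -> (size y < size x)%N -> y = 0).
    by exists x.
  move=> /not_all_ex_not[y] ny; have [yI {}ny] := imply_to_and _ _ ny.
  have [lt /eqP y0] := imply_to_and _ _ ny.
  by apply: (IH y) => //; apply: leq_trans lt _; rewrite -ltnS.
exists r, a; split=> //.
have cP i : exists2 c, c != 0 & divides r (c%:P * F i).
  pose c := lead_coef r ^+ Pdiv.CommonRing.rscalp (F i) r.
  have c0 : c != 0 by rewrite expf_neq0 ?lead_coef_eq0.
  exists c => //; exists (Pdiv.CommonRing.rdivp (F i) r).
  have e := Pdiv.ComRing.rdivp_eq r (F i).
  have m0 : Pdiv.CommonRing.rmodp (F i) r = 0.
    apply: rmin; last by rewrite Pdiv.CommonRing.ltn_rmodp.
    have [b bE] := inF i.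
    exists (fun l => c%:P * b l - Pdiv.CommonRing.rdivp (F i) r * a l).
    under eq_bigr do rewrite mulrBl -!mulrA.
    rewrite sumrB -!mulr_sumr -bE -ra mul_polyC.
    by move: e; rewrite -/c => ->; rewrite addrC addKr.
  by rewrite mul_polyC; move: e; rewrite m0 addr0.
have [b b0 bF] := fin_all_exists2 cP.
exists (\prod_i b i); first by apply/prodf_neq0 => i _.
move=> i; rewrite (bigD1 i) //= mulrC polyCM mulrA mulrC.
by apply: divides_mull; rewrite mulrC.
Qed.

(** The content of [F] is the gcd over the fraction field, made primitive ([r1]), times the content
    [g] of the quotients [G]. Strong primitivity of what remains rests on a Bezout relation: some
    combination of the [H i] is a nonzero constant [C'], and Gauss's lemma removes [C'] again. *)
Lemma has_contents_poly (D : idomainType) : has_contents D -> has_contents {poly D}.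
Proof.
move=> cD I F nzF; have [r [a [r0 rE [c c0 cF]]]] := pseudo_principal nzF.
have coefs_prim (J : finType) (G : J -> {poly D}) : (exists i, G i != 0) ->
    exists (g : D) (H : J -> {poly D}), [/\ g != 0, primitive_family (fun x : J * nat => (H x.1)`_x.2) &
       forall i, G i = g%:P * H i].
  (* Contents in [D] are available for finite families only; [N] bounds all sizes, so the
     coefficients are indexed by [J * 'I_N]. *)
  move=> [i Gi]; pose N := \max_i size (G i).
  have ltN l n : (N <= n)%N -> (G l)`_n = 0.
    by move=> leN; rewrite nth_default // (leq_trans _ leN) // leq_bigmax.
  have [|g [h [hprim hE]]] := cD _ (fun x : J * 'I_N => (G x.1)`_x.2).
    have lt : ((size (G i)).-1 < N)%N.
      by rewrite (leq_trans _ (leq_bigmax i)) // prednK ?size_poly_gt0.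
    by exists (i, Ordinal lt); rewrite /= -lead_coefE lead_coef_eq0.
  pose H l := \poly_(n < N) (if insub n is Some n' then h (l, n') else 0).
  have HE l (n : 'I_N) : (H l)`_n = h (l, n) by rewrite coef_poly ltn_ord valK.
  exists g, H; split.
  - apply: contraNneq Gi => g0; apply/eqP/polyP=> n; rewrite coef0.
    have [/ltN -> //|lt] := leqP N n.
    by have /= -> := hE (i, Ordinal lt); rewrite g0 mul0r.
  - by move=> x y xy; apply: hprim => -[l n]; rewrite -HE; apply: (xy (l, nat_of_ord n)).
  - move=> l; apply/polyP=> n; rewrite mul_polyC coefZ.
    have [le|lt] := leqP N n; first by rewrite ltN // coef_poly ltnNge le mulr0.
    by rewrite -[n]/(nat_of_ord (Ordinal lt)) HE; apply: (hE (l, Ordinal lt)).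
have [|C [R [C0 Rprim rR]]] := coefs_prim 'I_1 (fun _ => r); first by exists ord0.
move: rR => /(_ ord0); set r1 := R ord0 => rR.
have r1F i : divides r1 (F i).
  have [b bE] := cF i.
  have [|b' b'E] := @gauss_contents D 'I_1 R c (b * C%:P) Rprim.
    move=> l; rewrite (ord1 l) -mulrA -/r1 -rR -bE mulrC.
    by apply: divides_mull; exists 1; rewrite mul1r.
  exists b'; apply: (mulfI (x := c%:P)); first by rewrite polyC_eq0.
  by rewrite bE rR mulrA b'E mulrA (mulrC c%:P).
have [G GE] := fin_all_exists r1F.
have [|g [H [g0 Hprim HE]]] := coefs_prim I G.
  by case: nzF => i Fi; exists i; apply: contraNneq Fi => G0; rewrite GE G0 mul0r.
have r10 : r1 != 0 by apply: contraNneq r0 => e; rewrite rR e mulr0.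
have aG : \sum_i a i * G i = C%:P.
  apply: (mulIf r10); rewrite mulr_suml -rR rE; apply: eq_bigr => i _.
  by rewrite -mulrA -GE.
have [C' C'0 aH] : exists2 C', C' != 0 & \sum_i a i * H i = C'%:P.
  have e : g%:P * (\sum_i a i * H i) = C%:P.
    by rewrite -aG mulr_sumr; apply: eq_bigr => i _; rewrite HE mulrCA.
  have s1 : size (\sum_i a i * H i) = 1%N.
    have h0 : \sum_i a i * H i != 0.
      by apply: contra_eq_neq e => ->; rewrite mulr0 eq_sym polyC_eq0.
    by have := congr1 (size : {poly D} -> nat) e; rewrite size_Cmul ?size_polyC ?C0 ?g0.
  exists (\sum_i a i * H i)`_0; last by apply: size1_polyC; rewrite s1.
  have: \sum_i a i * H i != 0 by rewrite -size_poly_eq0 s1.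
  by rewrite [X in X != 0]size1_polyC ?s1 // polyC_eq0.
exists (g%:P * r1), H; split; last by move=> i; rewrite GE HE mulrAC.
move=> x h hx.
have [b bE] := fin_all_exists hx.
have [h0|h0] := eqVneq h 0.
  have [i Fi] := nzF; exists 0; rewrite mul0r; apply/eqP.
  have : x * H i == 0 by rewrite bE h0 mulr0.
  rewrite mulf_eq0 => /orP[//|/eqP Hi].
  by rewrite GE HE Hi mulr0 mul0r eqxx in Fi.
have xC : x * C'%:P = (\sum_i a i * b i) * h.
  rewrite -aH mulr_sumr mulr_suml; apply: eq_bigr => i _.
  by rewrite mulrCA bE mulrA.
(* After cancelling [h], the combination of the [b i], times [H i], equals [b i * C']. *)
have [|b' b'E] := gauss_contents (c := C') (q := \sum_i a i * b i) Hprim.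
  move=> i; exists (b i); apply: (mulIf h0); rewrite mulrAC -xC.
  by rewrite mulrAC bE mulrAC.
exists b'; apply: (mulIf (x := C'%:P)); first by rewrite polyC_eq0.
by rewrite xC b'E mulrAC.
Qed.

Lemma has_contents_iso (D D' : comNzRingType) (f : {rmorphism D -> D'}) g :
  cancel f g -> cancel g f -> has_contents D' -> has_contents D.
Proof.
move=> fK gK cD' I F [i Fi].
have gM : {morph g : x y / x * y} by move=> x y; apply: (can_inj fK); rewrite rmorphM !gK.
have [|h [F' [prim F'E]]] := cD' I (f \o F).
  by exists i; rewrite /= -(rmorph0 f) (can_eq fK).
exists (g h), (g \o F'); split; last by move=> l; rewrite /= -gM -F'E fK.
move=> x y xy; have [|b bE] := prim (f x) (f y).
  by move=> l; have [b bE] := xy l; exists (f b); rewrite -[F' l]gK -!rmorphM bE.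
by exists (g b); rewrite -[x]fK bE gM fK.
Qed.

Lemma has_contents_field (k : fieldType) : has_contents k.
Proof.
move=> I F [i Fi]; exists 1, F; split; last by move=> l; rewrite mul1r.
move=> x y /(_ i)[b bE]; exists (b / F i); rewrite mulrAC -bE mulfK //.
Qed.

(** * Multivariate polynomials as polynomials in the last variable *)

Lemma mpoly_rmorphism_eq (R S : comNzRingType) n (f g : {rmorphism {mpoly R[n]} -> S}) :
  (forall c, f c%:MP = g c%:MP) -> (forall i, f 'X_i = g 'X_i) -> f =1 g.
Proof.
move=> fgC fgX; elim/mpolyind => [|c m q _ _ IHq]; first by rewrite !rmorph0.
rewrite !rmorphD /= IHq; congr (_ + _).
rewrite -mul_mpolyC !rmorphM fgC; congr (_ * _).
rewrite mpolyXE_id !rmorph_prod; apply: eq_bigr => i _.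
by rewrite !rmorphXn /= fgX.
Qed.

Lemma muniX_max (R : comNzRingType) n : muni 'X_(@ord_max n) = 'X :> {poly {mpoly R[n]}}.
Proof.
rewrite muniE msuppX big_seq1 mcoeffX eqxx scale1r mnm1E eqxx expr1.
have -> : [multinom U_(@ord_max n)%MM (widen i) | i < n] = 0%MM.
  by apply/mnmP=> i; rewrite mnmE mnm1E mnm0E eq_sym -val_eqE /= ltn_eqF.
by rewrite mpolyX0 scale1r.
Qed.

Lemma muniX_widen (R : comNzRingType) n (i : 'I_n) :
  muni 'X_(widen i) = ('X_i)%:P :> {poly {mpoly R[n]}}.
Proof.
rewrite muniE msuppX big_seq1 mcoeffX eqxx scale1r mnm1E -val_eqE /= ltn_eqF //.
have -> : [multinom U_(widen i)%MM (widen l) | l < n] = U_(i)%MM.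
  by apply/mnmP=> l; rewrite mnmE !mnm1E -!val_eqE.
by rewrite expr0 alg_polyC.
Qed.

Definition mpoly_of_poly (k : fieldType) n : {poly {mpoly k[n]}} -> {mpoly k[n.+1]} :=
  horner_morph (fun p : {mpoly k[n]} => mulrC 'X_(@ord_max n) (mwiden p)).

Lemma muniK (k : fieldType) n : cancel (@muni n k) (@mpoly_of_poly k n).
Proof.
rewrite /mpoly_of_poly; set g := horner_morph _.
apply: (mpoly_rmorphism_eq (f := g \o @muni n k) (g := idfun)) => [c|i] /=.
  by rewrite muniC /g horner_morphC /= mwidenC.
have [i' ->|->] := unliftP ord_max i; last by rewrite muniX_max /g horner_morphX.
have -> : lift ord_max i' = widen i'.
  by apply: val_inj; rewrite /= /bump leqNgt ltn_ord.
by rewrite muniX_widen /g horner_morphC /= mwidenX mnmwiden1.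
Qed.

Lemma mpoly_of_polyK (k : fieldType) n : cancel (@mpoly_of_poly k n) (@muni n k).
Proof.
rewrite /mpoly_of_poly; set g := horner_morph _.
move=> q; elim/poly_ind: q => [|q c IHq]; first by rewrite /g !rmorph0.
rewrite {1}/g !rmorphD !rmorphM /= -/(g q) IHq; congr (_ * _ + _).
  by rewrite /g horner_morphX muniX_max.
rewrite /g horner_morphC /=.
apply: (mpoly_rmorphism_eq (f := @muni n k \o @mwiden n k) (g := polyC)) => [d|i] /=.
  by rewrite mwidenC muniC.
by rewrite mwidenX mnmwiden1 muniX_widen.
Qed.

Lemma has_contents_mpoly (k : fieldType) n : has_contents {mpoly k[n]}.
Proof.
elim: n => [|n IH].
  apply: (has_contents_iso (f := @mcoeff 0 k 0%MM) (g := @mpolyC 0 k)).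
  - move=> q; apply/mpolyP=> m.
    have -> : m = 0%MM by apply/mnmP => -[].
    by rewrite mcoeffC eqxx mulr1.
  - by move=> c; have /= -> := mcoeffC c 0%MM; rewrite eqxx mulr1.
  exact: has_contents_field.
by apply: (has_contents_iso (@muniK k n) (@mpoly_of_polyK k n)); apply: has_contents_poly.
Qed.

(** The row factor [v] is the primitive part of one nonzero row. The minors make every row
    proportional to [v] over the fraction field, and primitivity of [v] puts the factor in [D]. *)
Lemma rank1_factor (D : idomainType) (S I : finType) (w : S -> I -> D) :
  has_contents D ->
  (forall s s' i i', w s i * w s' i' = w s i' * w s' i) ->
  (exists s i, w s i != 0) ->
  exists h v, forall s i, w s i = h s * v i.
Proof.
move=> cD minors [s0 [i0 wi0]].
have [|g [v [vprim vE]]] := cD I (w s0); first by exists i0.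
have g0 : g != 0 by apply: contraNneq wi0 => g0; rewrite vE g0 mul0r.
have vi0 : v i0 != 0 by apply: contraNneq wi0 => v0; rewrite vE v0 mulr0.
have cross s i i' : w s i * v i' = w s i' * v i.
  by apply: (mulfI g0); rewrite mulrCA -vE mulrCA -vE minors.
have dv s : divides (v i0) (w s i0).
  by apply: vprim => i; exists (w s i); rewrite cross.
have [h hE] := fin_all_exists dv.
exists h, v => s i; apply: (mulIf vi0).
by rewrite cross hE mulrAC.
Qed.

End Contents.

(** * Measures and derivations *)

Lemma linfunE (k : fieldType) (A B : vectType k) (f : A -> B) :
  linear f -> linfun f =1 f.
Proof.
move=> lin x; pose F : {linear A -> B} := HB.pack f
  (GRing.isLinear.Build k A B _ f lin).
exact: (lfunE F).
Qed.

Lemma ecoord_neq0 (k : fieldType) (L : vectType k) (v : L) :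
  v != 0 -> exists i, ecoord i v != 0.
Proof.
move=> v0; apply/existsP; apply: contraT => /existsPn h; case/eqP: v0.
by rewrite [LHS]ecoordK big1 // => i _; have /negPn/eqP -> := h i; rewrite scale0r.
Qed.

Lemma dim1_vline (k : fieldType) (L : vectType k) (l : {vspace L}) :
  \dim l = 1%N -> l = <[vpick l]>%VS.
Proof.
move=> dl; apply/eqP; rewrite eq_sym eqEdim -memvE memv_pick dim_vline dl.
by rewrite vpick0 -dimv_eq0 dl.
Qed.

Lemma vline_scale (k : fieldType) (M : vectType k) (x : M) (c : k) : c != 0 -> <[c *: x]>%VS = <[x]>%VS.
Proof.
move=> c0; apply/eqP; rewrite eqEsubv -!memvE memvZ ?memv_line //=.
by rewrite -{1}[x](scalerK c0) memvZ ?memv_line.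
Qed.

Lemma functional_sep (k : fieldType) (L : vectType k) (W : {vspace L}) (u : L) : u \notin W ->
  exists2 l : 'Hom(L, k^o), l u = 1 & forall w, w \in W -> l w = 0.
Proof.
move=> uW; pose q := daddv_pi W^C W.
have qE x : q x + daddv_pi W W^C x = x.
  by apply: daddv_pi_add; rewrite ?[(W^C + _)%VS]addvC ?addv_complf ?memvf // capvC capv_compl.
have q0 w : w \in W -> q w = 0.
  move=> wW; have := qE w; rewrite (daddv_pi_id (capv_compl W) wW).
  by move/(canRL (addrK w)); rewrite subrr.
have [i ui] : exists i, ecoord i (q u) != 0.
  apply: ecoord_neq0; apply: contraNneq uW => qu0.
  by rewrite -[u]qE qu0 add0r memv_pi.
pose f x : k^o := (@ecoord k _ i (q u))^-1 * @ecoord k _ i (q x) : k.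
have fE : linfun f =1 f.
  by apply: linfunE => c x y; rewrite /f linearP /ecoord linearP /= mulrDr mulrCA.
exists (linfun f) => [|w wW]; rewrite fE /f; first by rewrite mulVf.
have -> : @ecoord k _ i (q w) = 0 by rewrite q0 // /ecoord; apply: linear0.
by rewrite mulr0.
Qed.

Lemma prodv_ind (k : fieldType) (A : falgType k) (U V : {vspace A}) (P : A -> Prop) :
  (forall a b, a \in U -> b \in V -> P (a * b)) ->
  (forall x y, P x -> P y -> P (x + y)) -> (forall c x, P x -> P (c *: x)) ->
  forall x, x \in (U * V)%VS -> P x.
Proof.
move=> PM PD PZ x; rewrite unlock => /(@coord_span _ _ _ (in_tuple _)) ->.
have P0 : P 0 by rewrite -(mul0r (0 : A)); apply: PM; apply: mem0v.
apply: (big_ind P) => // i _; apply: PZ.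
have /allpairsP[[a b] [aU bV ->]] := mem_nth 0 (ltn_ord i).
by apply: PM; apply: vbasis_mem.
Qed.

(** The kernel of [eps] has codimension 1, hence is maximal. It lies in every maximal ideal because
    [1 - a * x] is invertible, by a finite geometric series, whenever [x] is in the kernel. *)
Lemma Rad_augmentation (k : fieldType) (A : falgType k) (eps : 'Hom(A, k^o)) :
  commutative (@GRing.mul A) -> eps 1 = 1 -> {morph eps : x y / x * y} ->
  (forall x, eps x = 0 -> exists n, x ^+ n = 0) -> Rad A = lker eps.
Proof.
move=> mulC eps1 epsM nilI; apply/vspaceP=> x; apply/idP/idP; last first.
  rewrite memv_ker => /eqP x0; apply/RadP=> J [Jl Jn Jmax].
  apply: contraT => xJ; pose K := (fullv * <[x]> + J)%VS.
  have Kl : left_ideal K.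
    rewrite /left_ideal prodvDr subv_add (subv_trans Jl) ?addvSr // andbT.
    by rewrite prodvA (subv_trans _ (addvSl _ _)) // prodvSl // subvf.
  have [KJ|Kf] := Jmax K Kl (addvSr _ _).
    case/negP: xJ; rewrite -KJ -[x]mul1r; apply: (subvP (addvSl _ _)).
    by apply: memv_mul; rewrite ?memvf ?memv_line.
  have /memv_addP[_ /memv_cosetP[a _ ->] [y yJ e]] : 1 \in K by rewrite Kf memvf.
  have [n an] : exists n, (a * x) ^+ n = 0 by apply: nilI; rewrite epsM x0 mulr0.
  have yE : y = 1 - a * x by rewrite e addrC addKr.
  have J1 : 1 \in J.
    have -> : 1 = (\sum_(i < n) (a * x) ^+ i) * y.
      have := subrX1 (a * x) n; rewrite an sub0r => h.
      by rewrite mulC yE -[1 - a * x]opprB mulNr -h opprK.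
    by apply: (subvP Jl); apply: memv_mul; rewrite ?memvf.
  case/eqP: Jn; apply/eqP; rewrite eqEsubv subvf; apply/subvP=> z _.
  by rewrite -[z]mulr1; apply: (subvP Jl); apply: memv_mul; rewrite ?memvf.
move/RadP; apply; split.
- apply/prodvP=> a b _; rewrite !memv_ker => /eqP b0.
  by rewrite epsM b0 mulr0.
- apply/eqP=> If; have : 1 \in lker eps by rewrite If memvf.
  by rewrite memv_ker eps1 oner_eq0.
move=> J _ IJ; have [JI|/subvPn[y yJ]] := boolP (J <= lker eps)%VS.
  by left; apply/eqP; rewrite eqEsubv JI.
rewrite memv_ker => y0; right; apply/eqP; rewrite eqEsubv subvf; apply/subvP=> z _.
have -> : z = (z - (eps z / eps y : k) *: y) + (eps z / eps y : k) *: y by rewrite subrK.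
rewrite memvD ?memvZ // (subvP IJ) // memv_ker linearB linearZ /=.
by rewrite -[_ *: _]/(_ * _) mulfVK ?subrr.
Qed.

Section Measure.
Variables (k : fieldType) (E : finGroupScheme k).
Implicit Types (u v : measure_alg E) (c : coordring E).

Lemma measure_mulE u v x :
  (u * v) x = tlift (fun a b => (u a * v b : k^o)) (comul E x).
Proof. exact: convE. Qed.

Lemma measure1E x : (1 : measure_alg E) x = counit E x.
Proof. by []. Qed.

Lemma measure11 : (1 : measure_alg E) 1 = 1.
Proof. by rewrite measure1E rmorph1. Qed.

Lemma measure_mul1 u v : (u * v) 1 = u 1 * v 1.
Proof. by rewrite measure_mulE rmorph1 tliftE //; apply: bilin_mul. Qed.

Lemma measure_exp1 u n : (u ^+ n) 1 = u 1 ^+ n.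
Proof.
elim: n => [|n IH]; first by rewrite !expr0 measure11.
by rewrite !exprS measure_mul1 IH.
Qed.

Lemma tlift_swap (A B Z : vectType k) (f : B -> A -> Z) (t : tens A B) :
  bilin f -> tlift f (tlift (fun a b => pure b a) t) = tlift (fun a b => f b a) t.
Proof.
move=> bf; have bs : bilin (fun (a : A) (b : B) => pure b a).
  by split=> z c x y; rewrite ?(pureDl, pureZl) ?(pureDr, pureZr).
have bf' : bilin (fun a b => f b a) by case: bf.
elim/tens_ind: t => [s t IH1 IH2|a b]; first by rewrite !linearD /= IH1 IH2.
by rewrite !tliftE.
Qed.

Lemma measure_mulC : abelian_scheme E -> commutative (@GRing.mul (measure_alg E)).
Proof.
move=> ab u v; apply/lfunP=> x; rewrite !measure_mulE -[in LHS]ab tlift_swap.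
  by apply: eq_bigr => i _; apply: eq_bigr => j _; rewrite mulrC.
exact: bilin_mul.
Qed.

Definition primitive_elt c := comul E c = pure c 1 + pure 1 c.

Definition hit c : 'End(measure_alg E) :=
  linfun (fun u : measure_alg E => (u \o amull c)%VF : measure_alg E).

Lemma hitE c u x : hit c u x = u (c * x).
Proof.
rewrite linfunE ?comp_lfunE ?lfunE // => d v w; apply/lfunP=> y.
by rewrite !(comp_lfunE, add_lfunE, scale_lfunE).
Qed.

(** The product of measures is dual to [comul], which is multiplicative; the two terms of
    [comul E c] become the two terms of the Leibniz rule. *)
Lemma hitM c u v : primitive_elt c -> hit c (u * v) = hit c u * v + u * hit c v.
Proof.
move=> pc; apply/lfunP=> x.
rewrite add_lfunE hitE !measure_mulE rmorphM /= pc.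
elim/tens_ind: (comul E x) => [s t IH1 IH2|a b].
  by rewrite mulrDr !linearD /= IH1 IH2 addrACA.
by rewrite mulrDl !pureM !mul1r linearD /= !tliftE ?hitE //; apply: bilin_mul.
Qed.

Lemma measure_coordP (l : 'Hom(measure_alg E, k^o)) :
  exists c, forall u, l u = u c.
Proof.
pose d (i : 'I_(\dim {:coordring E})) : measure_alg E := linfun (fun x => @ecoord k _ i x : k^o).
have dE i x : d i x = ecoord i x by rewrite linfunE // => a y z; rewrite /ecoord linearP.
exists (\sum_i l (d i) *: ebasis i) => u.
have {1}-> : u = \sum_(i < \dim {:coordring E}) u (ebasis i) *: d i.
  apply/lfunP=> x; rewrite sum_lfunE [in LHS](ecoordK x) linear_sum.
  by apply: eq_bigr => i _; rewrite linearZ scale_lfunE dE; apply: mulrC.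
rewrite !linear_sum; apply: eq_bigr => i _.
by rewrite !linearZ; apply: mulrC.
Qed.

Lemma tens_sep (A B : vectType k) (s t : tens A B) :
  (forall (u : 'Hom(A, k^o)) (v : 'Hom(B, k^o)),
    tlift (fun a b => (u a * v b : k^o)) s = tlift (fun a b => (u a * v b : k^o)) t) ->
  s = t.
Proof.
move=> st; apply/matrixP=> i j.
pose u : 'Hom(A, k^o) := linfun (fun x => @ecoord k _ i x : k^o).
pose v : 'Hom(B, k^o) := linfun (fun x => @ecoord k _ j x : k^o).
have uE x : u x = ecoord i x by rewrite linfunE // => a y z; rewrite /ecoord linearP.
have vE x : v x = ecoord j x by rewrite linfunE // => a y z; rewrite /ecoord linearP.
suff E' (r : tens A B) : tlift (fun a b => (u a * v b : k^o)) r = (r : 'M_(_, _)) i j.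
  by rewrite -!E' st.
rewrite /tlift (bigD1 i) //= (bigD1 j) //= !big1 ?addr0.
- by rewrite uE vE !ecoord_ebasis !eqxx mulr1 [LHS]mulr1.
- by move=> i' ne; rewrite big1 // => j' _;
     rewrite uE ecoord_ebasis eq_sym (negPf ne) mul0r scaler0.
- by move=> j' ne; rewrite vE ecoord_ebasis eq_sym (negPf ne) mulr0 scaler0.
Qed.

(** Seen as a functional on measures, [c] is a derivation at the augmentation; pairs of measures
    separate tensors, which gives the formula for [comul E c]. *)
Lemma primitiveP c :
  (forall u v, (u * v) c = u c * v 1 + u 1 * v c) -> primitive_elt c.
Proof.
move=> cM; apply: tens_sep => u v; rewrite -[LHS](@measure_mulE u v) cM.
by rewrite linearD /= !tliftE //; apply: bilin_mul.
Qed.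

Definition augmentation : 'Hom(measure_alg E, k^o) :=
  linfun (fun u : measure_alg E => u 1).

Lemma augmentationE u : augmentation u = u 1.
Proof.
by apply: linfunE => d v w; rewrite !(add_lfunE, scale_lfunE).
Qed.

End Measure.

(** * Measures with scalar p-th power *)

Section FrobeniusScalar.
Variables (k : fieldType) (p : nat) (pchar_k : p \in [pchar k]).

Definition frobenius_scalar (E : finGroupScheme k) (u : measure_alg E) :=
  u ^+ p = (u 1 : k) ^+ p *: (1 : measure_alg E).

Lemma pchar_falg (A : falgType k) : p \in [pchar A].
Proof.
apply/andP; split; first exact: pcharf_prime pchar_k.
by rewrite -(scaler_nat p (1 : A)) (pcharf0 pchar_k) scale0r.
Qed.

Section Closure.
Variables (E : finGroupScheme k) (abE : abelian_scheme E).
Let mulC := measure_mulC abE.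
Implicit Types u v : measure_alg E.

Lemma frobenius_scalarD u v :
  frobenius_scalar u -> frobenius_scalar v -> frobenius_scalar (u + v).
Proof.
move=> uE vE; have ch := pchar_falg (measure_alg E).
rewrite /frobenius_scalar -(pFrobenius_autE ch) pFrobenius_autD_comm; last exact: mulC.
rewrite !pFrobenius_autE uE vE add_lfunE -!(pFrobenius_autE pchar_k).
by rewrite rmorphD scalerDl.
Qed.

Lemma frobenius_scalarZ c u : frobenius_scalar u -> frobenius_scalar (c *: u).
Proof.
by move=> uE; rewrite /frobenius_scalar exprZn uE scale_lfunE /= exprMn scalerA.
Qed.

Lemma frobenius_scalarM u v :
  frobenius_scalar u -> frobenius_scalar v -> frobenius_scalar (u * v).
Proof.
move=> uE vE; rewrite /frobenius_scalar exprMn_comm; last exact: mulC.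
by rewrite uE vE measure_mul1 exprMn -scalerAl mul1r scalerA.
Qed.

Lemma frobenius_scalar_sum (I : finType) (F : I -> measure_alg E) :
  (forall i, frobenius_scalar (F i)) -> frobenius_scalar (\sum_i F i).
Proof.
move=> QF; apply: (big_ind (@frobenius_scalar E)) => // [|u v].
  rewrite /frobenius_scalar zero_lfunE expr0n.
  have /prime_gt0 := pcharf_prime pchar_k; case: (p) => // n _.
  by rewrite expr0n scale0r.
exact: frobenius_scalarD.
Qed.

End Closure.

Lemma Ga_comulX_eq r (T := tvar k (p ^ r)) :
  comul (Ga_kernel pchar_k r) T = pure T 1 + pure 1 T.
Proof. exact: tpoly_evalX. Qed.

Lemma Ga_kernel_abelian r : abelian_scheme (Ga_kernel pchar_k r).
Proof.
set C := coordring (Ga_kernel pchar_k r).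
have bs : bilin (fun (a : C) (b : C) => pure b a).
  by split=> z c x y; rewrite ?(pureDl, pureZl) ?(pureDr, pureZr).
have sM : {morph tlift (fun (a : C) (b : C) => pure b a) : s t / s * t}.
  move=> s t; elim/tens_ind: s => [? ? IH1 IH2|a b].
    by rewrite mulrDl !linearD /= IH1 IH2 mulrDl.
  elim/tens_ind: t => [? ? IH1 IH2|c d].
    by rewrite mulrDr !linearD /= IH1 IH2 mulrDr.
  by rewrite pureM !tliftE // pureM.
move=> x; elim/(@tpoly_ind k (p ^ r)): x => [||x y Px Py|c x y Px Py].
- by rewrite rmorph1 tliftE.
- by rewrite Ga_comulX_eq linearD /= !tliftE // addrC.
- by rewrite rmorphM sM Px Py.
- by rewrite !linearP /= Px Py.
Qed.

Lemma derivation_exp (A : falgType k) (D : 'End(A)) (u : A) n :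
  commutative (@GRing.mul A) ->
  (forall a b, D (a * b) = D a * b + a * D b) ->
  D (u ^+ n.+1) = (u ^+ n * D u) *+ n.+1.
Proof.
move=> mulC DM; elim: n => [|n IH]; first by rewrite expr0 mul1r.
rewrite exprS DM IH -mulrnAr mulrA -exprS mulrnAr [D u * _]mulC.
by rewrite -mulrS.
Qed.

(* D = hit T is a derivation, so D(u^p) = p u^(p-1) D u = 0, i.e. u^p
   vanishes on the multiples of T. *)
Lemma Ga_kernel_frobenius r (u : measure_alg (Ga_kernel pchar_k r)) :
  frobenius_scalar u.
Proof.
have mulC := measure_mulC (@Ga_kernel_abelian r).
have prT : primitive_elt (tvar k (p ^ r) : coordring (Ga_kernel pchar_k r)).
  exact: Ga_comulX_eq.
have p_gt0 : (0 < p)%N by rewrite prime_gt0 ?(pcharf_prime pchar_k).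
have Dp : hit (tvar k (p ^ r) : coordring (Ga_kernel pchar_k r)) (u ^+ p) = 0.
  have := @derivation_exp _ (hit _) u p.-1 mulC (fun a b => hitM a b prT).
  rewrite prednK // => ->.
  by rewrite -mulr_natl (pcharf0 (pchar_falg _)) mul0r.
pose T : coordring (Ga_kernel pchar_k r) := tvar k (p ^ r).
have key n : (u ^+ p) (T ^+ n) = ((u 1 : k) ^+ p *: (1 : measure_alg _)) (T ^+ n).
  rewrite scale_lfunE measure1E; case: n => [|n].
    by rewrite expr0 rmorph1 [RHS]mulr1 measure_exp1.
  rewrite exprS -hitE Dp zero_lfunE rmorphM.
  rewrite [X in _ *: (X * _)](_ : _ = 0) ?mul0r ?scaler0 //.
  exact: tpoly_evalX.
apply/lfunP=> x; rewrite (@tpolyE k (p ^ r) x) !linear_sum.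
by apply: eq_bigr => i _; rewrite !linearZ; congr (_ *: _); apply: key.
Qed.

End FrobeniusScalar.

Section Constant.
Variables (k : fieldType) (G : finZmodType).
Local Notation CG := (constant_group k G).

Definition point_measure (g : G) : measure_alg CG :=
  linfun (fun f : gfun k G => f g : k^o).

Lemma point_measureE g (f : gfun k G) : point_measure g f = f g.
Proof. by rewrite linfunE // => c x y; rewrite !ffunE. Qed.

Lemma constant_comulE (f : gfun k G) :
  comul CG f = \sum_g \sum_h f (g + h) *: pure (gdelta k g) (gdelta k h).
Proof. by rewrite [LHS]lfunE. Qed.

Lemma point_measureM g h : point_measure g * point_measure h = point_measure (g + h).
Proof.
apply/lfunP=> f; rewrite measure_mulE constant_comulE linear_sum (bigD1 g) //=.
rewrite linear_sum (bigD1 h) //= !big1 ?addr0.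
- rewrite linearZ /= tliftE; last exact: bilin_mul.
  by rewrite !point_measureE !ffunE !eqxx mulr1 [LHS]mulr1.
- move=> g' ne; rewrite linear_sum big1 // => h' _.
  rewrite linearZ /= tliftE; last exact: bilin_mul.
  by rewrite !point_measureE !ffunE eq_sym (negPf ne) mul0r scaler0.
- move=> h' ne; rewrite linearZ /= tliftE; last exact: bilin_mul.
  by rewrite !point_measureE !ffunE (eq_sym h) (negPf ne) mulr0 scaler0.
Qed.

Lemma point_measure0 : point_measure 0 = 1.
Proof. by apply/lfunP=> f; rewrite !point_measureE. Qed.

Lemma point_measureX g n : point_measure g ^+ n = point_measure (g *+ n).
Proof.
elim: n => [|n IH]; first by rewrite mulr0n point_measure0.
by rewrite exprS IH point_measureM mulrS.
Qed.

Lemma measure_pointE (u : measure_alg CG) :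
  u = \sum_g u (gdelta k g) *: point_measure g.
Proof.
apply/lfunP=> f; rewrite sum_lfunE {1}(gfunE f) linear_sum.
apply: eq_bigr => g _; rewrite linearZ scale_lfunE point_measureE; exact: mulrC.
Qed.

Lemma constant_abelian : abelian_scheme CG.
Proof.
have bs : bilin (fun a b : gfun k G => pure b a).
  by split=> z c x y; rewrite ?(pureDl, pureZl) ?(pureDr, pureZr).
move=> f; rewrite constant_comulE linear_sum [RHS]exchange_big.
apply: eq_bigr => g _; rewrite linear_sum; apply: eq_bigr => h _ /=.
by rewrite linearZ /= tliftE // addrC.
Qed.

End Constant.

Section Pushforward.
Variables (k : fieldType) (G H : finGroupScheme k).
Variable phi : 'AHom(coordring H, coordring G).
Hypothesis phi_hom : group_hom phi.

Lemma pushforwardM : {morph pushforward phi : u v / u * v}.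
Proof.
move=> u v; apply/lfunP=> x; rewrite pushforwardE !measure_mulE phi_hom.
elim/tens_ind: (comul H x) => [s t IH1 IH2|a b].
  by rewrite !linearD /= IH1 IH2.
by rewrite tmapE !tliftE ?pushforwardE //; apply: bilin_mul.
Qed.

(* pushforward 1 is an idempotent; as an algebra morphism k[H] -> k it is
   invertible for the convolution, with inverse given by the antipode. *)
Lemma pushforward1 : pushforward phi 1 = 1.
Proof.
set e := pushforward phi 1.
have ee : e * e = e by rewrite -pushforwardM mul1r.
have eE x : e x = counit G (phi x) by rewrite pushforwardE measure1E.
pose e' : measure_alg H := (e \o antipode H)%VF.
have ee' : e * e' = 1.
  apply/lfunP=> x; rewrite measure_mulE measure1E.
  have <- : counit G (phi (tlift (fun a b => a * antipode H b) (comul H x))) = counit H x.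
    by rewrite antipoder !linearZ /= !rmorph1 [LHS]mulr1.
  elim/tens_ind: (comul H x) => [s t IH1 IH2|a b].
    by rewrite !linearD /= IH1 IH2.
  rewrite !tliftE ?comp_lfunE ?eE ?rmorphM //; last exact: bilin_mul.
  exact: (bilin_mul (idfun : {linear coordring H -> coordring H}) (antipode H)).
by rewrite -[e]mulr1 -ee' mulrA ee.
Qed.

Lemma pushforwardX u n : pushforward phi (u ^+ n) = pushforward phi u ^+ n.
Proof.
elim: n => [|n IH]; first by rewrite !expr0 pushforward1.
by rewrite !exprS pushforwardM IH.
Qed.

End Pushforward.

Section ElementaryAbelian.
Variables (k : fieldType) (p : nat) (pchar_k : p \in [pchar k]).

(** Measures are combinations of point measures, whose p-th powers are 1 since ['Z_p] has exponent
    p. *)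
Lemma constant_frobenius (u : measure_alg (constant_group k 'Z_p)) :
  frobenius_scalar p u.
Proof.
have p_gt1 : (1 < p)%N by rewrite prime_gt1 ?(pcharf_prime pchar_k).
rewrite [u]measure_pointE; apply: (frobenius_scalar_sum pchar_k).
  exact: constant_abelian.
move=> g; apply: frobenius_scalarZ.
rewrite /frobenius_scalar point_measureX point_measureE ffunE expr1n scale1r.
by rewrite -mulr_natr pchar_Zp // mulr0 point_measure0.
Qed.

Lemma isomorphic_frobenius (G H : finGroupScheme k) :
  isomorphic G H -> (forall u : measure_alg H, frobenius_scalar p u) ->
  forall u : measure_alg G, frobenius_scalar p u.
Proof.
case=> phi phi_hom [psi phiK psiK] QH u.
have inj v w : pushforward phi v = pushforward phi w -> v = w.
  by move=> e; apply/lfunP=> x; rewrite -[x]psiK -!pushforwardE e.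
apply: inj; rewrite pushforwardX // QH pushforwardE rmorph1 linearZ /=.
by rewrite pushforward1.
Qed.

Lemma elementary_abelian_frobenius (E : finGroupScheme k) :
  elementary_abelian pchar_k E -> forall u : measure_alg E, frobenius_scalar p u.
Proof.
case=> abE [n [G [iota [Giso [emb prodE]]]]] u.
have: u \in fullv by apply: memvf.
rewrite -prodE; move: u.
pose P (V : {vspace measure_alg E}) := forall u, u \in V -> frobenius_scalar p u.
apply: (big_ind P) => [u /vlineP[c ->]|U V PU PV|i _ u].
- apply: frobenius_scalarZ; rewrite /frobenius_scalar.
  by rewrite measure11 !expr1n scale1r.
- apply: prodv_ind => [a b aU bV|x y|c x].
  + exact: frobenius_scalarM (PU _ aU) (PV _ bV).
  + exact: (frobenius_scalarD pchar_k abE).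
  + exact: frobenius_scalarZ.
move/memv_imgP=> [v _ ->]; have [hom _] := emb i.
have QG : forall w : measure_alg (G i), frobenius_scalar p w.
  case: (Giso i) => [[r]|] /isomorphic_frobenius; apply.
    exact: Ga_kernel_frobenius.
  exact: constant_frobenius.
rewrite /frobenius_scalar -pushforwardX // QG linearZ /= pushforward1 //.
by rewrite pushforwardE rmorph1.
Qed.

Variables (E : finGroupScheme k).
Hypotheses (abE : abelian_scheme E)
           (QE : forall u : measure_alg E, frobenius_scalar p u).

Lemma prime_p : prime p. Proof. exact: pcharf_prime pchar_k. Qed.

Lemma Rad_measure : Rad (measure_alg E) = lker (augmentation E).
Proof.
apply: Rad_augmentation.
- exact: measure_mulC.
- by rewrite augmentationE measure11.
- by move=> u v; rewrite !augmentationE measure_mul1.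
move=> u; rewrite augmentationE => u0; exists p; rewrite QE u0 expr0n.
by rewrite gtn_eqF ?prime_gt0 ?prime_p // scale0r.
Qed.

Lemma Rad_measureP u : (u \in Rad (measure_alg E)) = (u 1 == 0).
Proof. by rewrite Rad_measure memv_ker augmentationE. Qed.

(** A functional killing 1 and the square of the radical is a derivation at the augmentation, hence
    evaluation at a primitive [c]. It can be normalised to be 1 at [u], and this value is the
    augmentation of [hit c u]. *)
Lemma derivation_at u : u \in Rad (measure_alg E) ->
  u \notin (Rad (measure_alg E) * Rad (measure_alg E))%VS ->
  exists2 D : 'End(measure_alg E), D u = 1 &
    forall a b, D (a * b) = D a * b + a * D b.
Proof.
set R := Rad _ => uR uR2; have mulC := measure_mulC abE.
have [|l lu lW] := @functional_sep k (measure_alg E) (<[1]> + R * R)%VS u.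
  apply: contra uR2 => /memv_addP[_ /vlineP[c ->] [z zR2 uE]].
  have zR : z \in R.
    have zI : (R * R <= R)%VS.
      apply/prodvP=> a b _; rewrite /R !Rad_measureP => /eqP b0.
      by rewrite measure_mul1 b0 mulr0.
    exact: (subvP zI).
  move: uR zR; rewrite /R !Rad_measureP uE add_lfunE scale_lfunE measure11.
  move=> /[swap] /eqP ->; rewrite addr0 [_ *: _]mulr1 => /eqP ->.
  by rewrite scale0r add0r.
have [c lE] := measure_coordP l.
have pc : primitive_elt c.
  apply: primitiveP => v w; rewrite -!lE.
  have dec (x : measure_alg E) : exists2 x', x' \in R & x = (x 1) *: 1 + x'.
    exists (x - (x 1 : k) *: (1 : measure_alg E)); last by rewrite addrC subrK.
    by rewrite /R Rad_measureP add_lfunE opp_lfunE scale_lfunE measure11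
       [_ *: _]mulr1 subrr.
  have l1 : l 1 = 0 by apply: lW; rewrite (subvP (addvSl _ _)) ?memv_line.
  have [v' v'R vE] := dec v; have [w' w'R wE] := dec w.
  have lvw : l (v' * w') = 0.
    by apply: lW; rewrite (subvP (addvSr _ _)) ?memv_mul.
  have lv : l v = l v' by rewrite vE linearD linearZ /= l1 scaler0 add0r.
  have lw : l w = l w' by rewrite wE linearD linearZ /= l1 scaler0 add0r.
  rewrite lv lw [in LHS]vE [in LHS]wE mulrDl !mulrDr -!scalerAl -!scalerAr !mul1r mulr1.
  by rewrite !linearD !linearZ /= l1 lvw !scaler0 add0r addr0 addrC mulrC.
(* As [w ^+ p = 1], the inverse of [w] is [w ^+ p.-1]; by commutativity, multiplying [hit c] by it
   preserves the Leibniz rule. *)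
pose w := hit c u; have w1 : w 1 = 1 by rewrite hitE mulr1 -lE lu.
have wp : w ^+ p = 1 by rewrite QE w1 expr1n scale1r.
exists (amull (w ^+ p.-1) \o hit c)%VF.
  by rewrite comp_lfunE lfunE /= -exprSr prednK ?prime_gt0 ?prime_p.
move=> a b; rewrite !comp_lfunE !lfunE /= hitM // mulrDr !mulrA.
by rewrite [_ * a]mulC -!mulrA.
Qed.

End ElementaryAbelian.

(** * Higman's criterion *)

Section Higman.
Variables (k : fieldType) (p : nat) (pchar_k : p \in [pchar k]) (A : falgType k).

(** Two consecutive ['C(p.-1, i)] add up to a binomial coefficient of p that is divisible by p. This
    is what turns the signed sum in [adn] into a relative trace. *)
Lemma bin_pred_sign i : (i < p)%N -> (-1) ^+ i * 'C(p.-1, i)%:R = 1 :> k.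
Proof.
have pp := pcharf_prime pchar_k; have p_gt0 := prime_gt0 pp.
elim: i => [|i IH] lt; first by rewrite bin0 mulr1.
have e : 'C(p.-1, i.+1)%:R = - 'C(p.-1, i)%:R :> k.
  apply/eqP; rewrite -subr_eq0 opprK -natrD -binS prednK //.
  by rewrite -(dvdn_pcharf pchar_k) prime_dvd_bin.
by rewrite e exprS mulN1r mulrNN IH // ltnW.
Qed.

Section Commutator.
Variable u : A.

(** The m-fold commutator of [F] with multiplication by [u], expanded binomially. *)
Definition adn m (F : A -> A) x :=
  \sum_(i < m.+1) ((-1) ^+ i * 'C(m, i)%:R : k) *: (u ^+ i * F (u ^+ (m - i) * x)).

Lemma adnS m F x : adn m.+1 F x = adn m (fun y => F (u * y) - u * F y) x.
Proof.
pose g i := ((-1) ^+ i * 'C(m, i)%:R : k) *: (u ^+ i * F (u ^+ (m.+1 - i) * x)).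
have -> : adn m (fun y => F (u * y) - u * F y) x =
    \sum_(i < m.+1) g i - \sum_(i < m.+1)
      ((-1) ^+ i * 'C(m, i)%:R : k) *: (u ^+ i.+1 * F (u ^+ (m - i) * x)).
  rewrite -sumrB; apply: eq_bigr => i _; rewrite /g -scalerBr; congr (_ *: _).
  rewrite mulrBr mulrA -exprS subSn -1?ltnS //.
  by congr (_ - _); rewrite !mulrA -exprSr.
have -> : \sum_(i < m.+1) g i = \sum_(i < m.+2) g i.
  by rewrite [RHS]big_ord_recr /= {3}/g bin_small ?mulr0 ?scale0r ?addr0.
rewrite /adn [LHS]big_ord_recl [X in _ = X - _]big_ord_recl /= /g !bin0 -addrA; congr (_ + _).
rewrite -sumrB; apply: eq_bigr => i _; rewrite /bump leq0n add1n subSS -scalerBl.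
congr (_ *: _); rewrite binS natrD mulrDr; congr (_ + _).
by rewrite exprS mulN1r mulNr.
Qed.

Lemma eq_adn m F G x : F =1 G -> adn m F x = adn m G x.
Proof. by move=> e; apply: eq_bigr => i _; rewrite e. Qed.

Lemma adnZ m c F x : adn m (fun y => c *: F y) x = c *: adn m F x.
Proof.
rewrite /adn scaler_sumr; apply: eq_bigr => i _.
by rewrite -scalerAr !scalerA mulrC.
Qed.

Variable D : 'End(A).
Hypotheses (Du : D u = 1) (DM : forall a b, D (a * b) = D a * b + a * D b).

(** The Weyl algebra relation: commuting with [u] differentiates powers of [D]. *)
Lemma iter_derivation n y :
  iter n.+1 D (u * y) = u * iter n.+1 D y + n.+1%:R *: iter n D y.
Proof.
elim: n => [|n IH]; first by rewrite /= DM Du mul1r scale1r addrC.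
rewrite iterS IH linearD linearZ /= DM Du mul1r [_ + u * _]addrC -addrA.
by congr (_ + _); rewrite -[X in X + _]scale1r -scalerDl addrC natr1.
Qed.

Lemma adn_iter m x : adn m (iter m D) x = m`!%:R *: x.
Proof.
elim: m x => [|m IH] x; first by rewrite /adn big_ord1 /= bin0 !expr0 !mul1r !scale1r.
rewrite adnS (@eq_adn _ _ (fun y => m.+1%:R *: iter m D y)); last first.
  by move=> y; rewrite iter_derivation addrC addKr.
by rewrite adnZ IH scalerA -natrM factS.
Qed.

Lemma higman_identity :
  exists s : 'End(A), forall x, \sum_(i < p) u ^+ i * s (u ^+ (p.-1 - i) * x) = x.
Proof.
have pp := pcharf_prime pchar_k; have p_gt0 := prime_gt0 pp.
have f0 : (p.-1)`!%:R != 0 :> k.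
  rewrite -(dvdn_pcharf pchar_k); apply/negP => dv.
  have := Wilson (prime_gt1 pp); rewrite pp -addn1 => /esym.
  by rewrite dvdn_addr // dvdn1 => /eqP p1; rewrite p1 in pp.
pose f x := (p.-1)`!%:R^-1 *: iter p.-1 D x.
have fE : linfun f =1 f.
  apply: linfunE => c x y; rewrite /f scalerA mulrC -scalerA -scalerDr; congr (_ *: _).
  by elim: (p.-1) => //= n ->; rewrite linearP.
exists (linfun f) => x; have := adn_iter p.-1 x.
rewrite /adn prednK // => e; rewrite -[RHS](scalerK f0) -e scaler_sumr.
apply: eq_bigr => i _; rewrite fE /f bin_pred_sign // scale1r.
by rewrite scalerAr.
Qed.

End Commutator.

(* Higman's criterion: the relative trace of s is the identity, so averaging
   a k-linear lift against s makes it k[t]-linear. *)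
Lemma higman_projective (alpha : 'AHom(tpoly k p, A)) (u := alpha (tvar k p)) :
  (exists s : 'End(A), forall x, \sum_(i < p) u ^+ i * s (u ^+ (p.-1 - i) * x) = x) ->
  projective (restr alpha).
Proof.
have pp := pcharf_prime pchar_k; have p_gt0 := prime_gt0 pp.
case=> s sE M N g f surj; pose T := tvar k p.
have [m mE] := fin_all_exists
  (fun i : 'I_(\dim {:A}) => surj (f (ebasis i : restr alpha))).
have scE (a : tpoly k p) (x : restr alpha) : a *: x = alpha a * (x : A) :> A by [].
have scA (c : k) (x : restr alpha) : c%:A *: x = c *: (x : A) :> A.
  by rewrite scE linearZ /= rmorph1 -scalerAl mul1r.
(* A lift that is only k-linear, built on a basis; [M] is a module over k[T]/(T^p), so a scalar [c]
   acts on it as [c%:A]. *)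
pose h0 (x : A) : M := \sum_i (@ecoord k A i x)%:A *: m i.
have h0P c x y : h0 (c *: x + y) = c%:A *: h0 x + h0 y.
  rewrite /h0 scaler_sumr -big_split; apply: eq_bigr => i _ /=.
  by rewrite /ecoord linearP scalerDl scalerDl scalerA -scalerAl mul1r scalerA.
have h00 : h0 0 = 0.
  by rewrite /h0 big1 // => i _; rewrite /ecoord linear0 scale0r scale0r.
have gh0 x : g (h0 x) = f (x : restr alpha).
  rewrite {2}(@ecoordK k A x) linear_sum.
  have -> : f (\sum_i ecoord i x *: ebasis i : A) =
      f (\sum_i ((ecoord i x)%:A : tpoly k p) *: (ebasis i : restr alpha)).
    by congr (f _); apply: eq_bigr => i _; rewrite scA.
  rewrite linear_sum; apply: eq_bigr => i _.
  by rewrite !linearZ /= mE.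
pose h (x : restr alpha) : M :=
  \sum_(i < p) T ^+ i *: h0 (s (u ^+ (p.-1 - i) * (x : A))).
have hP c (x y : A) : h (c *: x + y) = c%:A *: h x + h y.
  rewrite /h scaler_sumr -big_split; apply: eq_bigr => i _ /=.
  rewrite mulrDr -scalerAr linearP h0P scalerDr; congr (_ + _).
  by rewrite !scalerA mulrC.
have hD (x y : A) : h (x + y) = h x + h y by have := hP 1 x y; rewrite !scale1r.
have hc (c : k) (x : A) : h (c *: x) = c%:A *: h x.
  have h_0 : h 0 = 0 by rewrite /h big1 // => i _; rewrite mulr0 linear0 h00 scaler0.
  by have := hP c x 0; rewrite !addr0 h_0 addr0.
have hT (x : A) : h (u * x) = T *: h x.
  (* Both sides are sums of consecutive [G i], shifted by one; the boundary terms vanish because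
     [u ^+ p = 0] and [T ^+ p = 0]. *)
  pose G i := T ^+ i *: h0 (s (u ^+ (p - i) * x)).
  transitivity (\sum_(i < p) G i).
    apply: eq_bigr => i _; rewrite mulrA -exprSr /G; congr (_ *: h0 (s (_ ^+ _ * _))).
    by rewrite -subSn ?prednK // -ltnS prednK.
  transitivity (\sum_(i < p) G i.+1); last first.
    rewrite /h scaler_sumr; apply: eq_bigr => i _.
    by rewrite scalerA -exprS /G -subn1 subnAC subn1 -subnS.
  have up : u ^+ p = 0 by rewrite /u -rmorphXn tvarXN ?rmorph0.
  have G0 : G 0%N = 0 by rewrite /G subn0 up mul0r linear0 h00 scaler0.
  have Gp : G p = 0 by rewrite /G tvarXN // scale0r.
  have : \sum_(i < p.+1) G i = \sum_(i < p.+1) G i by [].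
  by rewrite {1}big_ord_recr big_ord_recl /= G0 Gp addr0 add0r.
have hZ (a : tpoly k p) (x : restr alpha) : h (a *: x) = a *: h x.
  elim/tpoly_ind: a x => [||a b IHa IHb|c a b IHa IHb] x.
  - by rewrite !scale1r.
  - exact: hT.
  - by rewrite -!scalerA IHa IHb.
  - rewrite !scalerDl -mulr_algl -!scalerA hD IHb; congr (_ + _).
    by rewrite -IHa -hc -scA.
have hlin : linear h by move=> a x y; rewrite hD hZ.
pose H : {linear restr alpha -> M} :=
  HB.pack h (GRing.isLinear.Build (tpoly k p) (restr alpha) M _ h hlin).
exists H => x; rewrite -[H x]/(h x) /h linear_sum.
have -> : f x = f (\sum_(i < p) T ^+ i *: (s (u ^+ (p.-1 - i) * x) : restr alpha)).
  congr (f _); rewrite -[LHS]sE; apply: eq_bigr => i _.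
  by rewrite scE rmorphXn.
rewrite linear_sum; apply: eq_bigr => i _.
by rewrite !linearZ /= gh0.
Qed.

End Higman.

(** * Zeros and gradings of polynomials *)

Section ClosedFieldPolynomials.
Variable k : closedFieldType.

(** The polynomial [P + 1] takes only the value 1, so it has no root and is constant. *)
Lemma horner_eq0 (P : {poly k}) : (forall t, P.[t] = 0) -> P = 0.
Proof.
move=> P0; have [/eqP s1|ns1] := boolP (size (P + 1%:P) == 1%N).
  have P1 : P + 1%:P = ((P + 1%:P)`_0)%:P by apply: size1_polyC; rewrite s1.
  have PE : P = ((P + 1%:P)`_0 - 1)%:P by rewrite polyCB -P1 addrK.
  by have := P0 0; rewrite PE hornerC => ->.
have /closed_rootP[t] := ns1; rewrite /root hornerD P0 hornerC add0r.
by rewrite oner_eq0.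
Qed.

Lemma horner_eq (P Q : {poly k}) : (forall t, t != 0 -> P.[t] = Q.[t]) -> P = Q.
Proof.
move=> PQ; apply/eqP; rewrite -subr_eq0; apply/eqP.
have /eqP : (P - Q) * 'X = 0.
  apply: horner_eq0 => t; rewrite hornerM hornerX hornerD hornerN.
  have [->|t0] := eqVneq t 0; first by rewrite mulr0.
  by rewrite PQ // subrr mul0r.
by rewrite mulf_eq0 polyX_eq0 orbF => /eqP.
Qed.

Lemma rootless_const (P : {poly k}) :
  (forall t, P.[t] != 0) -> exists2 c, c != 0 & P = c%:P.
Proof.
move=> P0; have [/eqP s1|/closed_rootP[t]] := boolP (size P == 1%N); last first.
  by rewrite /root (negPf (P0 t)).
have PE : P = (P`_0)%:P by apply: size1_polyC; rewrite s1.
by exists P`_0 => //; have := P0 0; rewrite {1}PE hornerC.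
Qed.

Lemma meval_eq0 n (f : {mpoly k[n]}) : (forall v, f.@[v] = 0) -> f = 0.
Proof.
elim: n f => [|n IH] f f0.
  apply/mpolyP=> m; have -> : m = 0%MM by apply/mnmP => -[].
  rewrite mcoeff0 -(f0 (fun=> 0)) mevalE.
  have fE : f = (f@_0%MM)%:MP.
    apply/mpolyP=> m'; have -> : m' = 0%MM by apply/mnmP => -[].
    by rewrite mcoeffC eqxx mulr1.
  by rewrite -mevalE fE mevalC mcoeffC eqxx mulr1.
pose ext (v : 'I_n -> k) t (i : 'I_n.+1) := if unlift ord_max i is Some j then v j else t.
have ev v t : f.@[ext v t] = (map_poly (meval v) (muni f)).[t].
  apply: (mpoly_rmorphism_eq (f := meval (ext v t))
    (g := horner_eval t \o (map_poly (meval v) \o @muni n k))) => [c|i] /=.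
    by rewrite mevalC muniC map_polyC /= mevalC /horner_eval hornerC.
  rewrite mevalXU /ext /horner_eval; case: unliftP => [j ->|->].
    have -> : lift ord_max j = widen_ord (leqnSn n) j.
      by apply: val_inj; rewrite /= /bump leqNgt ltn_ord.
    by rewrite muniX_widen map_polyC /= mevalXU hornerC.
  by rewrite muniX_max map_polyX hornerX.
have muni_f : muni f = 0.
  apply/polyP=> i; rewrite coef0; apply: IH => v.
  have : map_poly (meval v) (muni f) = 0.
    by apply: horner_eq0 => t; rewrite -ev f0.
  by move/(congr1 (fun P : {poly k} => P`_i)); rewrite coef_map coef0.
by apply: (can_inj (@muniK k n)); rewrite muni_f rmorph0.
Qed.

Lemma meval_line n (f : {mpoly k[n]}) (a b : 'I_n -> k) :
  exists P : {poly k}, forall t, P.[t] = f.@[fun i => a i + t * b i].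
Proof.
exists (mmap (@polyC k) (fun i => (a i)%:P + b i *: 'X) f) => t; symmetry.
apply: (mpoly_rmorphism_eq (f := meval (fun i => a i + t * b i))
  (g := horner_eval t \o mmap (@polyC k) (fun i => (a i)%:P + b i *: 'X))) => [c|i] /=.
  by rewrite mevalC mmapC /horner_eval hornerC.
by rewrite mevalXU mmapX mmap1U /horner_eval hornerD hornerC hornerZ hornerX mulrC.
Qed.

End ClosedFieldPolynomials.

(** * Factors of homogeneous polynomials *)

Section Homogeneous.
Variables (k : fieldType) (n : nat).
Implicit Types f g : {mpoly k[n]}.

Lemma meval_homog f d (v : 'I_n -> k) t :
  f \is d.-homog -> f.@[fun i => t * v i] = t ^+ d * f.@[v].
Proof.
move=> /dhomogP hf; rewrite !mevalE mulr_sumr !big_seq; apply: eq_bigr => m mf.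
have md : mdeg m = d by exact: hf.
rewrite mulrCA; congr (_ * _); rewrite -md mdegE -prodrXr -big_split.
by apply: eq_bigr => i _; rewrite exprMn.
Qed.

Lemma monomial_factor (D : idomainType) (P Q : {poly D}) c d :
  c != 0 -> P * Q = c *: 'X^d -> exists a e, P = a *: 'X^e.
Proof.
move=> c0; elim: d P Q => [|d IH] P Q PQ.
  rewrite expr0 alg_polyC in PQ.
  have : P * Q != 0 by rewrite PQ polyC_eq0.
  rewrite mulf_eq0 negb_or => /andP[P0 Q0].
  have := congr1 (size : {poly D} -> nat) PQ.
  rewrite size_mul // size_polyC c0 => s1.
  have sP : (size P <= 1)%N.
    have sQ : (0 < size Q)%N by rewrite size_poly_gt0.
    by rewrite -(leq_add2r (size Q)) (leq_trans (leqSpred _)) // s1 add1n ltnS.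
  by exists P`_0, 0%N; rewrite expr0 alg_polyC -size1_polyC.
have facX (F : {poly D}) : root F 0 -> exists F', F = F' * 'X.
  by move/factor_theorem=> [F' ->]; exists F'; rewrite subr0.
have Xreg : injective (fun F : {poly D} => F * 'X) by apply: mulIf; rewrite polyX_eq0.
have : root P 0 || root Q 0.
  by rewrite -rootM PQ rootE hornerZ hornerXn expr0n mulr0.
case/orP=> /facX[F E]; subst.
  have [|a [e ->]] := IH F Q; last by exists a, e.+1; rewrite -scalerAl exprSr.
  by apply: Xreg; rewrite /= mulrAC PQ -scalerAl exprSr.
by apply: (IH P F); apply: Xreg; rewrite /= -mulrA PQ -scalerAl exprSr.
Qed.

(* f = sum of f_d, f_d homogeneous of degree d, goes to the sum of f_d T^d. *)
Definition grading : {mpoly k[n]} -> {poly {mpoly k[n]}} :=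
  mmap (polyC \o @mpolyC n k) (fun i => 'X_i *: 'X).

Lemma coef_grading f d : (grading f)`_d = pihomog [measure of mdeg] d f.
Proof.
rewrite pihomogE /grading /mmap coef_sum [RHS]big_mkcond /=; apply: eq_bigr => m _.
have -> : mmap1 (fun i => 'X_i *: 'X) m = 'X_[m] *: 'X^(mdeg m) :> {poly {mpoly k[n]}}.
  rewrite /mmap1 -mul_polyC mpolyXE_id rmorph_prod mdegE -prodrXr -big_split.
  by apply: eq_bigr => i _; rewrite -mul_polyC exprMn rmorphXn.
rewrite coefCM coefZ coefXn eq_sym; case: eqP => _; last by rewrite !mulr0.
by rewrite mulr1 mul_mpolyC.
Qed.

Lemma grading_homog f d : f \is d.-homog -> grading f = f *: 'X^d.
Proof.
move=> hf; apply/polyP=> i; rewrite coef_grading coefZ coefXn.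
have [->|ne] := eqVneq i d; first by rewrite mulr1 pihomog_dE.
by rewrite mulr0 (pihomog_ne0 _ hf) // eq_sym.
Qed.

Lemma homog_of_grading f a e : grading f = a *: 'X^e -> f \is e.-homog.
Proof.
move=> fE; apply/dhomogP=> m mf; apply: contraTeq mf => ne.
rewrite mcoeff_msupp negbK.
have {1}-> := pihomog_partitionE (leqnn (mmeasure [measure of mdeg] f)).
rewrite raddf_sum big1 // => d _ /=.
have [->|ne'] := eqVneq (d : nat) e; last first.
  by rewrite -coef_grading fE coefZ coefXn (negPf ne') mulr0 mcoeff0.
by apply: (dhomog_nemf_coeff (pihomogP _ e f)).
Qed.

(** Under the multiplicative map [grading], homogeneous elements become monomials in T, and a factor
    of a nonzero monomial over a domain is again a monomial. The number [(msize f).-1] is the degree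
    of [f]. *)
Lemma homog_factor f g d :
  f != 0 -> f * g \is d.-homog -> g \is (d - (msize f).-1).-homog.
Proof.
move=> f0 hfg; have [->|g0] := eqVneq g 0; first exact: dhomog0.
have grM : grading (f * g) = grading f * grading g by exact: rmorphM.
have c0 : f * g != 0 by rewrite mulf_neq0.
have e := grading_homog hfg; rewrite grM in e.
have [a [df fE]] := monomial_factor c0 e.
have [b [dg gE]] : exists a e, grading g = a *: 'X^e.
  by apply: (monomial_factor (Q := grading f) c0 (d := d)); rewrite mulrC.
have hf := homog_of_grading fE; have hg := homog_of_grading gE.
have -> : d = (df + dg)%N by apply: (dhomog_uniq c0 hfg); apply: dhomogM.
by rewrite (dhomog_uniq f0 (dhomog_msize hf) hf) addKn.
Qed.

End Homogeneous.

(** * Homogeneous functions and their degrees *)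

Section PolynomialFunctions.
Variables (k : fieldType) (L : vectType k).
Implicit Types (W V : {vspace L}) (phi : L -> k).

(** Forms on [W] and on a subspace are written in unrelated bases; recording only the values lets
    [homog_fun_sub] change coordinates without naming a substitution. *)
Definition homog_fun W d phi :=
  exists2 f : {mpoly k[\dim W]}, f \is d.-homog &
    forall x, x \in W -> phi x = f.@[fun a => coord (vbasis W) a x].

Lemma homog_fun_eq W d phi psi : phi =1 psi -> homog_fun W d phi -> homog_fun W d psi.
Proof. by move=> e [f hf fE]; exists f => // x xW; rewrite -e fE. Qed.

Lemma homog_fun_sum W d (I : Type) (r : seq I) (P : pred I) (F : I -> L -> k) :
  (forall i, P i -> homog_fun W d (F i)) ->
  homog_fun W d (fun x => \sum_(i <- r | P i) F i x).
Proof.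
move=> HF; elim: r => [|i r [g hg gE]].
  by exists 0 => [|x _]; rewrite ?dhomog0 // big_nil meval0.
have [Pi|nPi] := boolP (P i); last first.
  by exists g => // x xW; rewrite big_cons (negPf nPi) gE.
have [f hf fE] := HF i Pi; exists (f + g) => [|x xW]; first exact: dhomogD.
by rewrite big_cons Pi mevalD fE // gE.
Qed.

Lemma homog_funM W d e phi psi :
  homog_fun W d phi -> homog_fun W e psi -> homog_fun W (d + e) (fun x => phi x * psi x).
Proof.
move=> [f hf fE] [g hg gE]; exists (f * g) => [|x xW]; first exact: dhomogM.
by rewrite mevalM fE // gE.
Qed.

Lemma homog_fun_cst W c : homog_fun W 0 (fun=> c).
Proof.
exists c%:MP => [|x _]; last by rewrite mevalC.
by rewrite -[c%:MP]mulr1 mul_mpolyC; apply: dhomogZ; apply: dhomog1.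
Qed.

Lemma homog_funZ W d c phi : homog_fun W d phi -> homog_fun W d (fun x => c * phi x).
Proof. exact: (homog_funM (homog_fun_cst W c)). Qed.

Lemma homog_fun_prod W (I : Type) (r : seq I) (e : I -> nat) (F : I -> L -> k) :
  (forall i, homog_fun W (e i) (F i)) ->
  homog_fun W (\sum_(i <- r) e i) (fun x => \prod_(i <- r) F i x).
Proof.
move=> HF; elim: r => [|i r IH].
  rewrite big_nil; apply: homog_fun_eq (homog_fun_cst W 1) => x.
  by rewrite big_nil.
rewrite big_cons; apply: homog_fun_eq (homog_funM (HF i) IH) => x.
by rewrite big_cons.
Qed.

Lemma homog_funX W d n phi : homog_fun W d phi -> homog_fun W (d * n) (fun x => phi x ^+ n).
Proof.
move=> H; elim: n => [|n IH]; first by rewrite muln0; apply: homog_fun_cst.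
rewrite mulnS; apply: homog_fun_eq (homog_funM H IH) => x.
by rewrite exprS.
Qed.

Lemma homog_fun_linear W (l : L -> k^o) : linear l -> homog_fun W 1 l.
Proof.
move=> lin; exists (\sum_(a < \dim W) l (vbasis W)`_a *: 'X_a).
  by apply: rpred_sum => a _; apply: dhomogZ; rewrite dhomogX; apply/eqP; apply: mdeg1.
move=> x xW; rewrite -(linfunE lin) {1}(coord_vbasis xW) !linear_sum /=.
by apply: eq_bigr => a _; rewrite mevalZ mevalXU mulrC -(linfunE lin) linearZ.
Qed.

Lemma homog_fun_det W d n (F : 'I_n -> 'I_n -> L -> k) :
  (forall a b, homog_fun W d (F a b)) ->
  homog_fun W (n * d) (fun x => \det (\matrix_(a, b) F a b x)).
Proof.
move=> HF; apply: homog_fun_sum => s _; apply: homog_funZ.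
have -> : (n * d = \sum_(a < n) d)%N by rewrite sum_nat_const card_ord.
apply: (@homog_fun_prod W _ _ (fun=> d)) => a.
by apply: homog_fun_eq (HF a _) => x; rewrite mxE.
Qed.

Lemma homog_fun_sub W V d phi : (V <= W)%VS -> homog_fun W d phi -> homog_fun V d phi.
Proof.
move=> VW [f hf fE].
suff [g hg gE] : homog_fun V d (fun x => f.@[fun a => coord (vbasis W) a x]).
  by exists g => // x xV; rewrite fE ?gE // (subvP VW).
apply: (homog_fun_eq (phi := fun x => \sum_(m <- msupp f | m \in msupp f)
    f@_m * \prod_a coord (vbasis W) a x ^+ m a)).
  by move=> x; rewrite mevalE [RHS]big_seq.
apply: homog_fun_sum => m mf; apply: homog_funZ.
have -> : d = (\sum_a m a)%N by rewrite -mdegE -(dhomog_mf hf mf).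
apply: homog_fun_prod => a.
have lin : linear (coord (vbasis W) a : L -> k^o) by move=> c x y; rewrite linearP.
by have := homog_funX (m a) (homog_fun_linear V lin); rewrite mul1n.
Qed.

Lemma homog_fun_scale V d phi c x :
  homog_fun V d phi -> x \in V -> phi (c *: x) = c ^+ d * phi x.
Proof.
move=> [f hf fE] xV; rewrite !fE ?memvZ // -(meval_homog _ _ hf).
by apply: meval_eq => a; rewrite linearZ.
Qed.

Lemma coord_surj W (v : 'I_(\dim W) -> k) :
  exists2 x, x \in W & forall a, coord (vbasis W) a x = v a.
Proof.
exists (\sum_a v a *: (vbasis W)`_a) => [|a].
  by apply: rpred_sum => a _; rewrite memvZ // vbasis_mem // mem_nth ?size_tuple.
by rewrite coord_sum_free // (basis_free (vbasisP W)).
Qed.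

Lemma plane_in V : (2 <= \dim V)%N ->
  exists v1 v2, [/\ v1 \in V, v2 \in V &
    forall s t, s *: v1 + t *: v2 = 0 -> s = 0 /\ t = 0].
Proof.
move=> dV; pose i0 := Ordinal (ltnW dV); pose i1 := Ordinal dV.
pose e (i : 'I_(\dim V)) := (vbasis V)`_i.
have eV i : e i \in V by rewrite vbasis_mem // mem_nth ?size_tuple.
have ce a b : coord (vbasis V) a (e b) = (a == b)%:R.
  by rewrite coord_free ?(basis_free (vbasisP V)) // eq_sym.
exists (e i0), (e i1); split=> // s t st.
have := congr1 (coord (vbasis V) i0) st; have := congr1 (coord (vbasis V) i1) st.
rewrite !linearD !linearZ !linear0 /= !ce !eqxx !mulr0 !mulr1 add0r addr0.
by move=> -> ->.
Qed.

End PolynomialFunctions.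

Section ClosedField.
Variables (k : closedFieldType) (L : vectType k).
Implicit Types (W V : {vspace L}) (phi : L -> k).

Lemma meval_coord_line W (f : {mpoly k[\dim W]}) x y :
  exists P : {poly k},
    forall t, P.[t] = f.@[fun a => coord (vbasis W) a (x + t *: y)].
Proof.
have [P PE] := meval_line f (fun a => coord (vbasis W) a x) (fun a => coord (vbasis W) a y).
by exists P => t; rewrite PE; apply: meval_eq => a; rewrite linearD linearZ.
Qed.

Lemma homog_fun_line V d phi x y : homog_fun V d phi -> x \in V -> y \in V ->
  exists P : {poly k}, forall t, P.[t] = phi (x + t *: y).
Proof.
move=> [f hf fE] xV yV; have [P PE] := meval_coord_line f x y.
by exists P => t; rewrite PE fE // memvD ?memvZ.
Qed.

(* On a projective line, both tuples are coprime binary forms, hence they are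
   proportional. *)
Lemma degree_unique V m (F F' : 'I_m -> L -> k) a b :
  (2 <= \dim V)%N ->
  (forall i, homog_fun V a (F i)) -> (forall i, homog_fun V b (F' i)) ->
  (forall x, x \in V -> x != 0 -> exists i, F i x != 0) ->
  (forall x, x \in V -> x != 0 -> exists i, F' i x != 0) ->
  (forall x, x \in V -> x != 0 -> forall i j, F i x * F' j x = F j x * F' i x) ->
  a = b.
Proof.
move=> dV HF HF' nzF nzF' prop; have [v1 [v2 [v1V v2V ind]]] := plane_in dV.
have nz1 t : v1 + t *: v2 != 0.
  apply/eqP=> e; have [|/eqP] := ind 1 t; first by rewrite scale1r.
  by rewrite oner_eq0.
have nz2 : v2 != 0.
  apply/eqP=> e; have [|_ /eqP] := ind 0 1; first by rewrite scale0r scale1r add0r.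
  by rewrite oner_eq0.
have V1 t : v1 + t *: v2 \in V by rewrite memvD ?memvZ.
(* The two affine charts of the projective line: [P], [P'] use v1 + t v2, while [Q], [Q'] use v2 + t
   v1 and see the point v2 at t = 0. *)
have [P PE] := fin_all_exists (fun i => homog_fun_line (HF i) v1V v2V).
have [P' P'E] := fin_all_exists (fun i => homog_fun_line (HF' i) v1V v2V).
have [Q QE] := fin_all_exists (fun i => homog_fun_line (HF i) v2V v1V).
have [Q' Q'E] := fin_all_exists (fun i => homog_fun_line (HF' i) v2V v1V).
have PP i j : P i * P' j = P j * P' i.
  by apply: horner_eq => t _; rewrite !hornerM !PE !P'E prop.
have [|r [c [r0 rE [e e0 re]]]] := @pseudo_principal k _ P.
  have [i Fi] := nzF _ (V1 0) (nz1 0); exists i.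
  by apply: contraNneq Fi => Pi; rewrite -PE Pi horner0.
have [r1 r10 rC] : exists2 r1, r1 != 0 & r = r1%:P.
  apply: rootless_const => t; apply/eqP=> rt.
  have [i /eqP[]] := nzF _ (V1 t) (nz1 t); rewrite -PE.
  have [h hE] := re i; have := congr1 (fun p : {poly k} => p.[t]) hE.
  rewrite /= !hornerM rt mulr0 hornerC => /eqP; rewrite mulf_eq0 (negPf e0).
  by move/eqP.
(* The Bezout relation for [r], transported to the second tuple; [q] has no root since the [P' j]
   have no common one. So the tuples differ by a constant factor in the first chart. *)
pose q := \sum_i c i * P' i.
have qP j : r * P' j = q * P j.
  rewrite rE !mulr_suml; apply: eq_bigr => i _.
  by rewrite -!mulrA PP [P' i * _]mulrC.
have [q1 q10 qC] : exists2 q1, q1 != 0 & q = q1%:P.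
  apply: rootless_const => t; apply/eqP=> qt.
  have [i /eqP[]] := nzF' _ (V1 t) (nz1 t); rewrite -P'E.
  have := congr1 (fun p : {poly k} => p.[t]) (qP i).
  rewrite /= !hornerM qt mul0r rC hornerC => /eqP; rewrite mulf_eq0 (negPf r10).
  by move/eqP.
have prop2 j t : r1 * F' j (v1 + t *: v2) = q1 * F j (v1 + t *: v2).
  have := congr1 (fun p : {poly k} => p.[t]) (qP j).
  by rewrite /= !hornerM qC rC !hornerC PE P'E.
have swap s : s != 0 -> v2 + s *: v1 = s *: (v1 + s^-1 *: v2).
  by move=> s0; rewrite scalerDr scalerA mulfV // scale1r addrC.
(* In the second chart homogeneity contributes the powers s^a and s^b. If a and b differed, one of
   the tuples would vanish at v2. *)
have QQ j : 'X^a * (r1 *: Q' j) = 'X^b * (q1 *: Q j).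
  apply: horner_eq => s s0; rewrite !hornerM !hornerZ !hornerXn QE Q'E swap //.
  rewrite (homog_fun_scale _ (HF j)) // (homog_fun_scale _ (HF' j)) //.
  rewrite (mulrCA r1) (mulrCA q1) prop2; exact: mulrCA.
have at0 (R : 'I_m -> {poly k}) (G : 'I_m -> L -> k) :
    (forall i t, (R i).[t] = G i (v2 + t *: v1)) ->
    (forall x, x \in V -> x != 0 -> exists i, G i x != 0) ->
    ~ (forall i, (R i).[0] = 0).
  move=> RE nzG R0; have [i] := nzG _ v2V nz2.
  by rewrite -[v2]addr0 -(scale0r v1) -RE R0 eqxx.
have cancelX n (G H : {poly k}) u v : u != 0 ->
    'X^n * (u *: G) = 'X^(n.+1 + v) * H -> G.[0] = 0.
  move=> u0; rewrite addSn -addnS exprD -mulrA.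
  have /mulfI h : 'X^n != 0 :> {poly k} by rewrite expf_neq0 // polyX_eq0.
  move/h/(congr1 (fun p : {poly k} => p.[0])).
  rewrite hornerZ hornerM hornerXn expr0n mul0r => /eqP.
  by rewrite mulf_eq0 (negPf u0) => /eqP.
case: (ltngtP a b) => // lt; exfalso.
  apply: (at0 Q' F' Q'E nzF') => i.
  have := cancelX a (Q' i) (q1 *: Q i) r1 (b - a.+1)%N r10.
  by rewrite subnKC //; apply; apply: QQ.
apply: (at0 Q F QE nzF) => i.
have := cancelX b (Q i) (r1 *: Q' i) q1 (a - b.+1)%N q10.
by rewrite subnKC //; apply; rewrite QQ.
Qed.

Section Representations.
Variables (L' : vectType k) (phi : {vspace L} -> {vspace L'}).

Lemma ecoord_poly_point W (f : 'I_(\dim {:L'}) -> {mpoly k[\dim W]}) x i :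
  ecoord i (poly_point f x) = (f i).@[fun a => coord (vbasis W) a x].
Proof.
rewrite /poly_point /ecoord linear_sum (bigD1 i) //= big1 ?addr0 => [|l ne].
  by rewrite linearZ /= -/(ecoord _ _) ecoord_ebasis eqxx mulr1.
by rewrite linearZ /= -/(ecoord _ _) ecoord_ebasis eq_sym (negPf ne) mulr0.
Qed.

Lemma poly_point_neq0 W (f : 'I_(\dim {:L'}) -> {mpoly k[\dim W]}) x :
  poly_point f x != 0 -> exists i, (f i).@[fun a => coord (vbasis W) a x] != 0.
Proof.
move=> nz; apply/existsP; apply: contraT => /existsPn f0; case/eqP: nz.
by rewrite /poly_point big1 // => i _; have /negPn/eqP -> := f0 i; rewrite scale0r.
Qed.

(** The two tuples may live on different spaces [W] and [W']; this is what allows a degree on the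
    radical to be compared with one on [V]. *)
Lemma represents_degree_unique W W' V X X' a b f f' :
  @represents k L L' W X phi a f -> @represents k L L' W' X' phi b f' ->
  (V <= W)%VS -> (V <= W')%VS -> (2 <= \dim V)%N ->
  (forall x, x \in V -> x != 0 -> X <[x]>%VS /\ X' <[x]>%VS) -> a = b.
Proof.
move=> [hf fE] [hf' f'E] VW VW' dV VX.
pose F i x := (f i).@[fun l => coord (vbasis W) l x].
pose F' i x := (f' i).@[fun l => coord (vbasis W') l x].
apply: (@degree_unique V _ F F') => //.
- by move=> i; apply: homog_fun_sub VW _; exists (f i).
- by move=> i; apply: homog_fun_sub VW' _; exists (f' i).
- move=> x xV x0; have [Xx _] := VX x xV x0; have [nz _] := fE x x0 Xx.
  exact: poly_point_neq0.
- move=> x xV x0; have [_ Xx] := VX x xV x0; have [nz _] := f'E x x0 Xx.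
  exact: poly_point_neq0.
move=> x xV x0 i j; have [Xx X'x] := VX x xV x0.
have [nz e] := fE x x0 Xx; have [nz' e'] := f'E x x0 X'x.
have /vlineP[c cE] : poly_point f x \in <[poly_point f' x]>%VS.
  by rewrite -e' e memv_line.
have FE l : F l x = c * F' l x.
  by rewrite /F /F' -!ecoord_poly_point cE /ecoord linearZ.
by rewrite !FE -!mulrA [F' i x * _]mulrC.
Qed.

(* A common divisor g has no zero on the cone over X; on V and on the lines
   through 0 it is then constant, k being algebraically closed. *)
Lemma represents_gcd_is_1 W V X d f : @represents k L L' W X phi d f ->
  (V <= W)%VS -> (2 <= \dim V)%N -> (forall x, x \in V -> x != 0 -> X <[x]>%VS) ->
  (forall x, x \in W ->
    exists v, forall s, s != 0 -> x + s *: v != 0 /\ X <[x + s *: v]>%VS) ->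
  gcd_is_1 f.
Proof.
move=> [hf fE] VW dV VX dense g gf.
pose ev x := g.@[fun a => coord (vbasis W) a x].
have ev_nz x : x != 0 -> X <[x]>%VS -> ev x != 0.
  move=> x0 Xx; have [nz _] := fE x x0 Xx; have [i] := poly_point_neq0 nz.
  have [h ->] := gf i; rewrite mevalM; apply: contraNneq => e.
  by rewrite -/(ev x) e mulr0.
have line x y : exists P : {poly k}, forall t, P.[t] = ev (x + t *: y).
  exact: meval_coord_line.
have const x y : (forall t, ev (x + t *: y) != 0) -> ev (x + y) = ev x.
  move=> nz; have [P PE] := line x y.
  have [|c _ Pc] := @rootless_const k P; first by move=> t; rewrite PE.
  have := PE 0; have := PE 1; rewrite scale1r scale0r addr0 Pc !hornerC.
  by move=> <- <-.
have ext x y x' y' : (forall t, t != 0 -> ev (x + t *: y) = ev (x' + t *: y')) ->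
    ev x = ev x'.
  move=> e; have [P PE] := line x y; have [P' P'E] := line x' y'.
  have PP : P = P' by apply: horner_eq => t t0; rewrite PE P'E e.
  by have := PE 0; have := P'E 0; rewrite !scale0r !addr0 PP => -> ->.
(* Homogeneity of [g] is not assumed, and 0 represents no point. For s nonzero the line through s v1
   in direction v2 avoids 0, so [ev] is constant on it; comparing at s = 0 gives [ev v2 = ev 0]. Two
   dimensions are essential here. *)
have ev0 : ev 0 != 0.
  have [v1 [v2 [v1V v2V ind]]] := plane_in dV.
  have nz s t : (s != 0) || (t != 0) -> ev (s *: v1 + t *: v2) != 0.
    move=> st; have x0 : s *: v1 + t *: v2 != 0.
      by apply: contraTneq st => /ind[-> ->]; rewrite eqxx.
    by apply: ev_nz => //; apply: VX => //; rewrite memvD ?memvZ.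
  have <- : ev v2 = ev 0.
    apply: (@ext v2 v1 0 v1) => s s0; rewrite add0r addrC; apply: const => t.
    by apply: nz; rewrite s0.
  by have := nz 0 1; rewrite scale0r add0r scale1r oner_eq0 orbT; apply.
have evX x : x != 0 -> X <[x]>%VS -> ev x = ev 0.
  move=> x0 Xx; rewrite -[x in LHS]add0r; apply: const => t; rewrite add0r.
  have [->|t0] := eqVneq t 0; first by rewrite scale0r.
  by apply: ev_nz; rewrite ?scaler_eq0 ?negb_or ?t0 // vline_scale.
(* A line through [x] that meets X for all nonzero parameters carries the value [ev 0] over to
   [x]. *)
have evW x : x \in W -> ev x = ev 0.
  move=> xW; have [v vP] := dense x xW; apply: (@ext x v 0 0) => s s0.
  by have [nz Xv] := vP s s0; rewrite evX // scaler0 addr0.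
exists (ev 0) => //; apply/eqP; rewrite -subr_eq0; apply/eqP/meval_eq0 => v.
have [x xW xE] := coord_surj v.
by rewrite mevalB mevalC -(meval_eq _ xE) -/(ev x) evW // subrr.
Qed.

Lemma represents_restrict W V X X' d f : @represents k L L' W X phi d f ->
  (V <= W)%VS -> (forall x, x != 0 -> X' <[x]>%VS -> x \in V /\ X <[x]>%VS) ->
  exists f', @represents k L L' V X' phi d f'.
Proof.
move=> [hf fE] VW X'X.
have H i : homog_fun V d (fun x => (f i).@[fun a => coord (vbasis W) a x]).
  by apply: homog_fun_sub VW _; exists (f i).
have [f' hf' f'E] := fin_all_exists2 H; exists f'; split=> // x x0 X'x.
have [xV Xx] := X'X x x0 X'x.
have -> : poly_point f' x = poly_point f x.
  by apply: eq_bigr => i _; rewrite -f'E.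
exact: fE.
Qed.

End Representations.

End ClosedField.

(** * Exterior powers and images *)

Section Wedge.
Variables (k : fieldType) (M : vectType k).

Lemma wedge_comb d (w b : 'I_d -> M) (P : 'M[k]_d) :
  (forall a, w a = \sum_c P a c *: b c) -> wedge w = \det P *: wedge b.
Proof.
move=> wE; apply/ffunP=> s; rewrite !ffunE -[RHS]/(_ * _) -det_mulmx.
congr (\det _); apply/matrixP=> a c; rewrite !mxE wE /ecoord linear_sum.
by apply: eq_bigr => l _; rewrite linearZ mxE.
Qed.

(** Coordinates of [ext_power] are indexed by increasing sequences, whereas a nonzero minor is found
    along an arbitrary injective selection; sorting relates the two. *)
Lemma incr_seq_perm d m (f : 'I_d -> 'I_m) : injective f ->
  exists (s : incr_seq d m) (pi : 'S_d), forall a, f a = val s (pi a).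
Proof.
move=> f_inj; pose le (x y : 'I_m) := (x <= y)%N; pose t := sort le (codom f).
have st : size t == d by rewrite size_sort size_codom card_ord.
have ut : uniq t by rewrite sort_uniq map_inj_uniq ?enum_uniq.
have tr : transitive le by move=> x y z; apply: leq_trans.
have tot : total le by move=> x y; apply: leq_total.
have srt : sorted le t by apply: sort_sorted.
pose s := [ffun a => tnth (Tuple st) a].
have s_incr : [forall a : 'I_d, forall b : 'I_d, (a < b)%N ==> (s a < s b)%N].
  apply/'forall_forallP=> a b; apply/implyP=> ab; rewrite !ffunE.
  rewrite !(tnth_nth (f a)) ltn_neqAle val_eqE nth_uniq ?size_tuple //= ltn_eqF //=.
  by apply: (sorted_ltn_nth tr) => //; rewrite inE (eqP st).
have ft a : f a \in t by rewrite mem_sort codom_f.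
have lt_i a : (index (f a) t < d)%N by rewrite -(eqP st) index_mem.
have pi_inj : injective (fun a => Ordinal (lt_i a)).
  move=> a b [e]; apply: f_inj.
  by rewrite -(nth_index (f a) (ft a)) e nth_index.
exists (exist _ s s_incr), (perm pi_inj) => a.
by rewrite permE ffunE (tnth_nth (f a)) nth_index.
Qed.

Lemma wedge_free_neq0 d (b : 'I_d -> M) :
  (forall v : 'rV[k]_d, \sum_a v 0 a *: b a = 0 -> v = 0) -> wedge b != 0.
Proof.
move=> free_b; pose B := \matrix_(a < d, l < \dim {:M}) ecoord l (b a).
have freeB : row_free B.
  apply: inj_row_free => v vB; apply: free_b.
  rewrite [LHS]ecoordK big1 // => l _.
  have := congr1 (fun N : 'rV_ _ => N 0 l) vB; rewrite !mxE => e.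
  rewrite /ecoord linear_sum (eq_bigr (fun a => v 0 a * B a l)) ?e ?scale0r //.
  by move=> a _; rewrite linearZ mxE.
have fullB : row_full B^T by rewrite /row_full mxrank_tr.
have := fullrowsub_unit fullB; set f := fullrankfun fullB => unitB.
have [s [pi fE]] := incr_seq_perm (@fullrankfun_inj _ _ _ _ fullB).
apply: contraTneq unitB => w0; rewrite unitmxE unitfE negbK.
pose C := \matrix_(a < d, c < d) ecoord (val s c) (b a).
have detC : \det C = 0 by have := congr1 (fun v : ext_power M d => v s) w0; rewrite !ffunE.
have -> : rowsub f B^T = (col_perm pi C)^T.
  by apply/matrixP=> a c; rewrite !mxE -fE.
by rewrite det_tr col_permE det_mulmx detC mul0r.
Qed.

Lemma wedge_vbasis_neq0 d (W : {vspace M}) : \dim W = d ->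
  wedge (fun a : 'I_d => (vbasis W)`_a) != 0.
Proof.
move=> dW; subst d; apply: wedge_free_neq0 => v v0; apply/rowP=> a.
have := congr1 (coord (vbasis W) a) v0.
by rewrite coord_sum_free ?(basis_free (vbasisP W)) // linear0 mxE.
Qed.

(** The basis [vbasis (limg f)] need not depend polynomially on [f], but the vectors [w s] do. Their
    factors relative to [wedge b] are the maximal minors of a matrix of full rank, so one of them is
    nonzero. *)
Lemma image_wedge d (f : 'End(M)) (b := fun a : 'I_d => (vbasis (limg f))`_a)
    (w := fun s : {ffun 'I_d -> 'I_(\dim {:M})} => wedge (fun a => f (ebasis (s a)))) :
  \dim (limg f) = d ->
  (forall s, exists c, w s = c *: wedge b) /\
  (exists s c, c != 0 /\ w s = c *: wedge b).
Proof.
move=> df; subst d; set W := limg f in b w *.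
pose P := \matrix_(i < \dim {:M}, c < \dim W) coord (vbasis W) c (f (ebasis i)).
have wE s : w s = \det (rowsub s P) *: wedge b.
  apply: wedge_comb => a; rewrite [LHS](coord_vbasis (memv_img _ (memvf _))).
  by apply: eq_bigr => c _; rewrite !mxE.
have fullP : row_full P.
  apply/row_fullP; exists (\matrix_(c, i) ecoord i (f^-1%VF (b c))).
  apply/matrixP=> c c'; rewrite !mxE.
  have bW : b c \in W by rewrite vbasis_mem // mem_nth ?size_tuple.
  transitivity (coord (vbasis W) c' (b c)); last first.
    by rewrite coord_free ?(basis_free (vbasisP W)).
  rewrite -[in RHS](limg_lfunVK bW) [in RHS](ecoordK (f^-1%VF (b c))) !linear_sum.
  by apply: eq_bigr => i _; rewrite !mxE !linearZ.
split=> [s|]; first by exists (\det (rowsub s P)).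
exists (fullrankfun fullP), (\det (rowsub (fullrankfun fullP) P)); split=> //.
by have := fullrowsub_unit fullP; rewrite unitmxE unitfE.
Qed.

(** Here [ecoord i] refers to the abstract basis [vbasis] of [ext_power]; the vectors [delta s]
    express it through the minors. *)
Lemma wedge_homog_fun (L : vectType k) (W : {vspace L}) d e (F : 'I_d -> L -> M) i :
  (forall a l, homog_fun W e (fun x => ecoord l (F a x))) ->
  homog_fun W (d * e) (fun x => ecoord i (wedge (F^~ x))).
Proof.
move=> HF.
pose delta (s : incr_seq d (\dim {:M})) : ext_power M d := [ffun s' => (s' == s)%:R].
apply: (homog_fun_eq (phi := fun x => \sum_s ecoord i (delta s) *
    \det (\matrix_(a, c) ecoord (val s c) (F a x)))) => [x|].
  have -> : wedge (F^~ x) = \sum_s (wedge (F^~ x) s : k) *: delta s.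
    apply/ffunP=> s; rewrite sum_ffunE (bigD1 s) //= big1 ?addr0 => [|s' ne].
      by rewrite !ffunE eqxx [RHS]mulr1.
    by rewrite !ffunE eq_sym (negPf ne) scaler0.
  rewrite /ecoord linear_sum; apply: eq_bigr => s _.
  by rewrite linearZ /= ffunE mulrC.
apply: homog_fun_sum => s _; apply: homog_funZ; apply: homog_fun_det => a c.
exact: HF.
Qed.

End Wedge.

(** * Polynomial equations for the image map *)

Section ImageMorphism.
Variables (k : closedFieldType) (A : falgType k) (M : fdmodule A) (j d : nat).
Local Notation R := (Rad A).
Local Notation plIm := (fun l : {vspace A} => pluecker d (Im_map M j l)).

Lemma act_pow_homog W i l :
  homog_fun W j (fun x => @ecoord k M l (act_pow M j x (ebasis i))).
Proof.
rewrite /act_pow; elim: j l => [|n IH] l.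
  apply: homog_fun_eq (homog_fun_cst W (@ecoord k M l (ebasis i))) => x.
  by rewrite id_lfunE.
rewrite -addn1; apply: (homog_fun_eq (phi := fun x => \sum_c
   @ecoord k M c (iter n (fun f => (act M x \o f)%VF) \1%VF (ebasis i)) *
   @ecoord k M l (act M x (ebasis c)))) => [x|].
  rewrite addn1 iterS comp_lfunE.
  set g := iter n _ _; move: (g (ebasis i)) => y.
  rewrite [in RHS](ecoordK y) linear_sum /ecoord linear_sum.
  by apply: eq_bigr => c _; rewrite !linearZ.
apply: homog_fun_sum => c _; apply: homog_funM; first exact: IH.
apply: homog_fun_linear => a x y.
by rewrite linearP add_lfunE scale_lfunE /ecoord linearP.
Qed.

Lemma U_space_line x : x \in R -> x \notin (R * R)%VS -> U_space A <[x]>%VS.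
Proof.
move=> xR xR2; have x0 : x != 0 by apply: contraNneq xR2 => ->; apply: mem0v.
by split; [split; rewrite ?dim_vline ?x0 // -memvE | rewrite -memvE].
Qed.

Lemma U_space_lineP x : U_space A <[x]>%VS -> x \in R /\ x \notin (R * R)%VS.
Proof. by case=> [[_]]; rewrite -!memvE. Qed.

(** An elementary form of density: together with [horner_eq], it extends polynomial identities from
    U to the whole radical. *)
Lemma U_space_dense v : v \in R -> v \notin (R * R)%VS -> forall x, x \in R ->
  exists v', forall s, s != 0 -> x + s *: v' != 0 /\ U_space A <[x + s *: v']>%VS.
Proof.
move=> vR vR2 x xR; have nz y : y \notin (R * R)%VS -> y != 0.
  by apply: contraNneq => ->; apply: mem0v.
have [xR2|xR2] := boolP (x \in (R * R)%VS); last first.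
  by exists 0 => s _; rewrite scaler0 addr0 nz //; split=> //; apply: U_space_line.
exists v => s s0; have h : x + s *: v \notin (R * R)%VS.
  apply: contra vR2 => h; rewrite -(scalerK s0 v) memvZ //.
  by rewrite -[s *: v](addKr x) memvD ?memvN.
by rewrite nz //; split=> //; apply: U_space_line; rewrite // memvD ?memvZ.
Qed.

Hypothesis rank_d :
  forall u, u \in R -> u \notin (R * R)%VS -> \dim (limg (act_pow M j u)) = d.

(* The d-fold wedges of the columns of u_M^j form a matrix of forms of rank 1;
   its row factor is the required tuple of polynomials. *)
Lemma Im_map_homogeneous : homogeneous R (U_space A) plIm.
Proof.
have [[v0 [v0R v0R2]]|noU] := classic (exists v, v \in R /\ v \notin (R * R)%VS);
    last first.
  exists 0%N, (fun=> 0); split=> [i|x x0 /U_space_lineP Ux]; first exact: dhomog0.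
  by case: noU; exists x.
pose m := \dim {:M}; pose S : finType := {ffun 'I_d -> 'I_m}.
pose ws (s : S) x := wedge (fun a => act_pow M j x (ebasis (s a))).
pose wb x := wedge (fun a : 'I_d => (vbasis (limg (act_pow M j x)))`_a).
have plE x : x != 0 -> plIm <[x]>%VS = <[wb x]>%VS by move=> x0; rewrite /= Im_mapE.
have H (si : S * 'I_(\dim {:ext_power M d})) :
    homog_fun R (d * j) (fun x => ecoord si.2 (ws si.1 x)).
  by apply: wedge_homog_fun => a l; apply: act_pow_homog.
have [w hw wE] := fin_all_exists2 H.
pose ev (f : {mpoly k[\dim R]}) x := f.@[fun a => coord (vbasis R) a x].
(* On U all wedges at [x] are multiples of the one vector [wb x], so the minors vanish there;
   density does the rest. *)
have minors s s' i i' : w (s, i) * w (s', i') = w (s, i') * w (s', i).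
  apply/eqP; rewrite -subr_eq0; apply/eqP/meval_eq0 => c.
  set g := _ - _; have [x xR xE] := coord_surj c.
  rewrite -(meval_eq _ xE) -/(ev g x).
  have evU y : y \in R -> y \notin (R * R)%VS -> ev g y = 0.
    move=> yR yR2; have [prop _] := image_wedge (rank_d yR yR2).
    have [e eE] := prop s; have [e' e'E] := prop s'.
    rewrite /ev /g mevalB !mevalM -!wE //= /ws eE e'E /ecoord !linearZ /=.
    by rewrite mulrACA [X in _ - X]mulrACA [X in _ * X - _]mulrC subrr.
  have [v' vP] := U_space_dense v0R v0R2 xR.
  have [P PE] := meval_coord_line g x v'.
  have P0 : P = 0.
    apply: horner_eq => s1 s10; rewrite PE horner0; have [_ /U_space_lineP[? ?]] := vP s1 s10.
    exact: evU.
  by have := PE 0; rewrite P0 horner0 scale0r addr0 => /esym.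
have nzw x : x \in R -> x \notin (R * R)%VS ->
    exists s c, [/\ c != 0, ws s x = c *: wb x & ws s x != 0].
  move=> xR xR2; have [_ [s [c [c0 sE]]]] := image_wedge (rank_d xR xR2).
  exists s, c; split=> //; rewrite /ws sE scaler_eq0 negb_or c0.
  by rewrite wedge_vbasis_neq0 ?rank_d.
have [s0 [c0 [_ _ nz0]]] := nzw v0 v0R v0R2.
have [i0 nzi0] := ecoord_neq0 nz0.
have w00 : w (s0, i0) != 0.
  by apply: contraNneq nzi0 => e; rewrite (wE (s0, i0)) // e meval0.
have [|||h [v wF]] := @rank1_factor {mpoly k[\dim R]} S _ (fun s i => w (s, i)).
- exact: has_contents_mpoly.
- exact: minors.
- by exists s0, i0.
have h0 : h s0 != 0 by apply: contraNneq w00 => e; rewrite wF e mul0r.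
exists (d * j - (msize (h s0)).-1)%N, v; split=> [i|x x0 /U_space_lineP[xR xR2]].
  by apply: homog_factor h0 _; rewrite -wF; apply: hw.
(* The row [s] depends on [x], since a fixed [h s] may vanish at [x]; [v] is the same for every
   row. *)
have [s [c [c1 sE snz]]] := nzw x xR xR2.
have vE : ws s x = (ev (h s) x) *: poly_point v x.
  rewrite [LHS]ecoordK /poly_point scaler_sumr; apply: eq_bigr => i _.
  by rewrite (wE (s, i)) // wF mevalM scalerA.
have e0 : ev (h s) x != 0 by apply: contraNneq snz => e; rewrite vE e scale0r.
split; first by apply: contraNneq snz => e; rewrite vE e scaler0.
by rewrite plE // -(vline_scale _ c1) -sE vE vline_scale.
Qed.

End ImageMorphism.

(** * Presentations and the main result *)

Section Presentation.
Variables (k : fieldType) (p : nat) (pchar_k : p \in [pchar k]) (E : finGroupScheme k).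
Hypotheses (abE : abelian_scheme E)
           (QE : forall u : measure_alg E, frobenius_scalar p u).
Local Notation R := (Rad (measure_alg E)).

(* The linear terms of a presentation are well defined modulo R^2. *)
Lemma dim_complement_ge2 n (V : {vspace measure_alg E}) :
  abelian_unipotent_rank p E n -> (2 <= n)%N -> (V + R * R)%VS = R -> (2 <= \dim V)%N.
Proof.
case=> phi phi_surj phi_ker n2 VR.
have p_gt1 : (1 < p)%N by rewrite prime_gt1 ?(pcharf_prime pchar_k).
(* Value and linear coefficients at the origin: [D i] kills the p-th powers of the variables, as p >
   1, and all products of two polynomials without constant term. *)
pose z (f : {mpoly k[n]}) := f.@[fun=> 0]; pose D i (f : {mpoly k[n]}) := z f^`M(i).
have DM i f g : D i (f * g) = D i f * z g + z f * D i g.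
  by rewrite /D /z mderivM mevalD !mevalM.
have DD i f g : D i (f + g) = D i f + D i g by rewrite /D /z mderivD mevalD.
have D0 i : D i 0 = 0 by rewrite /D /z mderiv0 meval0.
have zX i : z 'X_i = 0 by rewrite /z mevalXU.
have D_ker f i : phi f = 0 -> D i f = 0.
  case/phi_ker=> g ->; rewrite (big_morph (D i) (DD i) (D0 i)) big1 // => l _.
  have zXp m : (0 < m)%N -> z ('X_l ^+ m) = 0.
    by case: m => // m _; rewrite /z exprS mevalM -/(z 'X_l) zX mul0r.
  rewrite DM zXp ?(ltnW p_gt1) // -(prednK (ltnW p_gt1)) exprS DM zX zXp.
    by rewrite !(mulr0, mul0r, addr0).
  by rewrite -subn1 subn_gt0.
(* The p-th power of [phi 'X_i] is 0, and by [QE] it is the p-th power of the augmentation. *)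
have phiX i : phi 'X_i 1 = 0.
  have Xp : phi ('X_i ^+ p) = 0.
    apply/phi_ker; exists (fun l => (l == i)%:R); rewrite (bigD1 i) //= eqxx mul1r.
    by rewrite big1 ?addr0 // => l /negPf ->; rewrite mul0r.
  move: Xp; rewrite rmorphXn QE => /eqP; rewrite scaler_eq0 oner_eq0 orbF.
  by rewrite expf_eq0 => /andP[_ /eqP].
have phiZ c f : phi (c *: f) = c *: phi f by rewrite linearZ.
have phiB f g : phi (f - g) = phi f - phi g by rewrite rmorphB.
have augE f : phi f 1 = z f.
  elim/mpolyind: f => [|c m q _ _ IHq]; first by rewrite rmorph0 zero_lfunE /z meval0.
  rewrite rmorphD add_lfunE IHq /z mevalD; congr (_ + _).
  rewrite -[LHS]/(phi (c *: 'X_[m]) 1) phiZ scale_lfunE mevalZ; congr (_ * _).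
  rewrite [in LHS]mpolyXE_id rmorph_prod mevalX.
  rewrite (big_morph (fun u : measure_alg E => u 1) (@measure_mul1 k E) (measure11 E)).
  by apply: eq_bigr => i _; rewrite rmorphXn measure_exp1 -[RHS]/(_ ^+ _) -(phiX i).
have R2P x : x \in (R * R)%VS -> exists2 f, phi f = x & forall i, D i f = 0.
  move: x; apply: prodv_ind => [a b aR bR|x y|c x].
  - have [[f fE] [g gE]] := (phi_surj a, phi_surj b); exists (f * g) => [|i].
      by rewrite -fE -gE rmorphM.
    move: aR bR; rewrite !(Rad_measureP pchar_k abE QE) -fE -gE !augE.
    by move=> /eqP f0 /eqP g0; rewrite DM f0 g0 mulr0 mul0r addr0.
  - move=> [f fE f0] [g gE g0]; exists (f + g) => [|i]; first by rewrite -fE -gE rmorphD.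
    by rewrite DD f0 g0 addr0.
  - move=> [f fE f0]; exists (c *: f) => [|i]; first by rewrite -fE linearZ.
    by rewrite /D /z mderivZ mevalZ -/(z _) -/(D i f) f0 mulr0.
pose i0 := Ordinal (ltnW n2); pose i1 := Ordinal n2.
have DX i l : D i 'X_l = (l == i)%:R.
  rewrite /D mderivX mnm1E; have [->|_] := eqVneq l i; last by rewrite scale0r /z meval0.
  have -> : (U_(i) - U_(i) = 0 :> 'X_{1..n})%MM.
    by apply/mnmP=> m; rewrite mnmBE subnn mnm0E.
  by rewrite scale1r mpolyX0 /z meval1.
have lin_indep a b : phi (b *: 'X_i0 - a *: 'X_i1) \in (R * R)%VS -> a = 0 /\ b = 0.
  case/R2P=> f fE f0; have h i : D i (b *: 'X_i0 - a *: 'X_i1) = 0.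
    rewrite -(subrK f (_ - _)) DD f0 addr0; apply: D_ker.
    by rewrite -(subrr (phi f)) {1}fE; apply: rmorphB.
  have Dlin i : D i (b *: 'X_i0 - a *: 'X_i1) = b * (i0 == i)%:R - a * (i1 == i)%:R.
    by rewrite -!DX /D /z mderivB !mderivZ mevalB !mevalZ.
  have := h i0; have := h i1; rewrite !Dlin /= !mulr0 !mulr1 subr0 sub0r.
  by move/eqP; rewrite oppr_eq0 => /eqP -> ->.
rewrite leqNgt; apply/negP=> dV.
have [v vP] : exists v, (V <= <[v]>)%VS.
  have [->|V0] := eqVneq V 0%VS; first by exists 0; apply: sub0v.
  have dV1 : \dim V = 1%N by apply/eqP; rewrite eqn_leq -ltnS dV lt0n dimv_eq0.
  by exists (vpick V); rewrite {1}(dim1_vline dV1).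
have XV i : exists c r, r \in (R * R)%VS /\ phi 'X_i = c *: v + r.
  have : phi 'X_i \in (V + R * R)%VS by rewrite VR (Rad_measureP pchar_k abE QE) phiX.
  move=> /memv_addP[y yV [r rR ->]].
  by have /vlineP[c ->] := subvP vP y yV; exists c, r.
(* Modulo R^2 both variables map to multiples of [v]. Eliminating [v] forces a = b = 0, and then
   [phi 'X_i0] itself lies in R^2, again contrary to [lin_indep]. *)
have [a [r0 [r0R e0]]] := XV i0; have [b [r1 [r1R e1]]] := XV i1.
have comb : phi (b *: 'X_i0 - a *: 'X_i1) = b *: r0 - a *: r1.
  rewrite phiB !phiZ e0 e1 !scalerDr !scalerA mulrC opprD addrACA subrr.
  by rewrite add0r.
have [a0 b0] : a = 0 /\ b = 0.
  by apply: lin_indep; rewrite comb memvB ?memvZ.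
have [_ /eqP] : (0 : k) = 0 /\ (1 : k) = 0.
  apply: lin_indep; rewrite scale0r subr0 scale1r e0 a0 scale0r add0r.
  exact: r0R.
by rewrite oner_eq0.
Qed.

End Presentation.

Theorem theorem6p2p3 (k : closedFieldType) (p : nat) (pchar_k : p \in [pchar k])
    (E : finGroupScheme k) (elabE : elementary_abelian pchar_k E)
    (j : nat) (j_bounds : (1 <= j <= p.-1)%N)
    (M : fdmodule (measure_alg E)) (constM : constant_jrank p M j) :
  let d := jrank p M j in
  let R := Rad (measure_alg E) in
  let U := U_space (measure_alg E) in
  let plIm := fun l : {vspace measure_alg E} => pluecker d (Im_map M j l) in
  ((forall l, U l -> Gr d (Im_map M j l)) /\ homogeneous R U plIm) /\
  (forall n : nat, abelian_unipotent_rank p E n -> (2 <= n)%N ->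
   forall V : {vspace measure_alg E}, (V <= R)%VS ->
     (V + R * R)%VS = R -> (V :&: R * R)%VS = 0%VS ->
     (forall l, proj_space V l -> U l) /\
     degree R U plIm = degree V (proj_space V) plIm).
Proof.
move=> d R U plIm; have [abE _] := elabE.
have QE := elementary_abelian_frobenius elabE.
have p_gt0 : (0 < p)%N by rewrite prime_gt0 ?(pcharf_prime pchar_k).
have rank_d u : u \in R -> u \notin (R * R)%VS -> \dim (limg (act_pow M j u)) = d.
  move=> uR uR2; have [D Du DM] := derivation_at pchar_k abE QE uR uR2.
  have up : u ^+ p = 0.
    move: uR; rewrite (Rad_measureP pchar_k abE QE) => /eqP u0.
    by rewrite QE u0 expr0n gtn_eqF // scale0r.
  pose alpha := tpoly_eval p_gt0 up.
  have alphaT : alpha (tvar k p) = u by apply: tpoly_evalX.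
  have pp : p_point alpha.
    apply: (higman_projective pchar_k); rewrite alphaT.
    exact: (higman_identity pchar_k Du DM).
  by rewrite /d -(constM alpha pp) /rank_at alphaT.
have homR : homogeneous R U plIm by apply: Im_map_homogeneous.
split.
  split=> // l [[dl lR] lR2]; rewrite /Gr /Im_map rank_d //.
    by apply: (subvP lR); apply: memv_pick.
  by move: lR2; rewrite {1}(dim1_vline dl) -memvE.
move=> n rkn n2 V VR VR2 VcapR2.
have dV := dim_complement_ge2 pchar_k abE QE rkn n2 VR2.
have VU l : proj_space V l -> U l.
  move=> [dl lV]; split; first by split=> //; apply: subv_trans VR.
  apply/negP=> lR2; have : (l <= V :&: R * R)%VS by rewrite subv_cap lV.
  by rewrite VcapR2 subv0 -dimv_eq0 dl.
split=> //.
have PV x : x \in V -> x != 0 -> proj_space V <[x]>%VS.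
  by move=> xV x0; split; rewrite ?dim_vline ?x0 // -memvE.
have PVP x : proj_space V <[x]>%VS -> x \in V by case=> _; rewrite -memvE.
have [v [v2 [vV _ ind]]] := plane_in dV.
have v0 : v != 0.
  apply/eqP=> v0; have [|/eqP] := ind 1 0; first by rewrite v0 scaler0 scale0r addr0.
  by rewrite oner_eq0.
have [vR vR2] := U_space_lineP (VU _ (PV v vV v0)).
have [e [f repR]] := homR.
have [f' repV] : exists f', represents (W := V) (proj_space V) plIm e f'.
  apply: (represents_restrict repR VR) => x x0 Vx.
  by split; [apply: PVP | apply: VU].
have gcdR : gcd_is_1 f.
  apply: (represents_gcd_is_1 repR VR dV) => [x xV x0|x xR].
    by apply: VU; apply: PV.
  exact: (U_space_dense vR vR2).
(* The only vector of [V] that represents no point is 0; it is approached along the line spanned by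
   [v]. *)
have gcdV : gcd_is_1 f'.
  apply: (represents_gcd_is_1 repV (subvv V) dV) => // x xV.
  have [->|x0] := eqVneq x 0; last first.
    by exists 0 => s _; rewrite scaler0 addr0; split=> //; apply: PV.
  exists v => s s0; rewrite add0r; have sv0 : s *: v != 0 by rewrite scaler_eq0 negb_or s0.
  by split=> //; apply: PV => //; rewrite memvZ.
(* [degree] is chosen by [epsilon]; [f] and [f'] certify that there is something to choose, and
   uniqueness compares whichever tuples realise the chosen degrees. *)
have degR : is_degree R U plIm (degree R U plIm).
  by apply: epsilon_spec; exists e, f.
have degV : is_degree V (proj_space V) plIm (degree V (proj_space V) plIm).
  by apply: epsilon_spec; exists e, f'.
have [f1 rep1 _] := degR; have [f2 rep2 _] := degV.
apply: (represents_degree_unique rep1 rep2 VR (subvv V) dV) => x xV x0.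
by split; [apply: VU; apply: PV | apply: PV].
Qed.
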